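(* The ring of rational integers $(\mathbb{Z};0,1,+,\cdot,=)$ is uniformly positive existentially interpretable in the class of $L_t$-structures consisting of all $\mathcal{A}_R$, as $R$ ranges over integral domains of positive characteristic with a non-Archimedean absolute value.
   Context: For an integral domain $R$ with a non-Archimedean absolute value $|\cdot|$ (the trivial absolute value is allowed), the ring of entire functions over $R$ is $$\mathcal{A}_R=\Big\{\sum_{n\ge 0}c_nt^n\in R[[t]] : \forall r\in\mathbb{R}^+,\ \lim_{M\to\infty}|c_M|r^M=0\Big\},$$ regarded as a structure over $L_t=\{0,1,t,+,\cdot,=\}$ in the obvious way ($t$ is interpreted as the variable). Uniform interpretability: The base set of a structure $\mathfrak{M}$ is denoted $|\mathfrak{M}|$. The realization $s^{\mathfrak{M}}$ of a constant symbol is the singleton containing its interpretation, of an $n$-ary relation symbol is the corresponding subset of $|\mathfrak{M}|^n$, and of an $n$-ary function symbol is the graph of its interpretation in $|\mathfrak{M}|^{n+1}$; the realization of a formula $\phi(x_1,\dots,x_n)$ is $\phi^{\mathfrak{M}}=\{(m_1,\dots,m_n)\in|\mathfrak{M}|^n:\mathfrak{M}\text{ satisfies }\phi(m_1,\dots,m_n)\}$. Let $L,L'$ be languages, $\mathfrak{M}$ an $L$-structure and $\mathcal{N}$ a non-empty class of $L'$-structures. $\mathfrak{M}$ is uniformly interpretable (without parameters) in $\mathcal{N}$ if there are an $L'$-formula $\phi_L$ and, for each symbol $s\in L$ (including $=$ when listed in $L$, treated as a relation symbol), an $L'$-formula $\phi_s$ (all these formulas being independent of the structure in $\mathcal{N}$)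 such that for each $\mathfrak{N}\in\mathcal{N}$ there is a surjective map $\theta_{\mathfrak{N}}:\phi_L^{\mathfrak{N}}\to|\mathfrak{M}|$ satisfying: (i) $\phi_c^{\mathfrak{N}}\subseteq\phi_L^{\mathfrak{N}}$ and $\theta_{\mathfrak{N}}^{-1}(c^{\mathfrak{M}})=\phi_c^{\mathfrak{N}}$ for each constant symbol $c\in L$; (ii) $\phi_S^{\mathfrak{N}}\subseteq(\phi_L^{\mathfrak{N}})^n$ and $(\theta_{\mathfrak{N}}^n)^{-1}(S^{\mathfrak{M}})=\phi_S^{\mathfrak{N}}$ for each $n$-ary relation symbol $S\in L$; (iii) $\phi_f^{\mathfrak{N}}\subseteq(\phi_L^{\mathfrak{N}})^{n+1}$ and $(\theta_{\mathfrak{N}}^{n+1})^{-1}(f^{\mathfrak{M}})=\phi_f^{\mathfrak{N}}$ for each $n$-ary function symbol $f\in L$. Here $\phi_L$ may have several free variables, say $k$, so that $\phi_L^{\mathfrak{N}}\subseteq|\mathfrak{N}|^k$ and $(\phi_L^{\mathfrak{N}})^n$ is viewed inside $|\mathfrak{N}|^{kn}$; $\theta_{\mathfrak{N}}^n$ is the $n$-fold product map. The interpretation is positive existential if $\phi_L$ and all $\phi_s$ are positive existential, i.e. built from atomic formulas using only conjunctions, disjunctions and existential quantifiers. *)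

(* Defs.v *)
From HB Require Import structures.
From mathcomp Require Import all_boot all_order all_algebra.
From mathcomp Require Import all_classical all_reals all_analysis.

Set Implicit Arguments.
Unset Strict Implicit.
Unset Printing Implicit Defensive.
Import Order.TTheory GRing.Theory Num.Theory.
Import numFieldNormedType.Exports.

Local Open Scope classical_set_scope.
Local Open Scope ring_scope.

(* Equality is not a logical symbol: it is available in formulas only as a
   relation symbol of the language. *)
Record language := Language {
  cst_sym : Type;
  rel_sym : Type;
  rel_arity : rel_sym -> nat;
  fn_sym : Type;
  fn_arity : fn_sym -> nat }.

Record structure (L : language) := Structure {
  base_set :> Type;
  cst_interp : cst_sym L -> base_set;
  rel_interp : forall s : rel_sym L, set ('I_(rel_arity s) -> base_set);
  fn_interp : forall f : fn_sym L, ('I_(fn_arity f) -> base_set) -> base_set }.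
Arguments cst_interp {L} _ _.
Arguments rel_interp {L} _ _ _.
Arguments fn_interp {L} _ _ _.

Section Syntax.
Variable L : language.

Inductive term (V : Type) : Type :=
| Var of V
| Cst of cst_sym L
| App (f : fn_sym L) of ('I_(fn_arity f) -> term V).

(* [formula V] is the type of formulas with free variables among [V].  A
   quantifier acts on a formula over [option V], where it binds [None]. *)
Inductive formula (V : Type) : Type :=
| Atom (s : rel_sym L) of ('I_(rel_arity s) -> term V)
| Not of formula V
| And of formula V & formula V
| Or of formula V & formula V
| Imp of formula V & formula V
| Ex of formula (option V)
| All of formula (option V).

Fixpoint positive_existential (V : Type) (phi : formula V) : bool :=
  match phi with
  | Atom _ _ => true
  | And p q | Or p q => positive_existential p && positive_existential q
  | Ex p => positive_existential p
  | Not _ | Imp _ _ | All _ => false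
  end.

Variable M : structure L.

Fixpoint eval (V : Type) (e : V -> M) (u : term V) : M :=
  match u with
  | Var x => e x
  | Cst c => cst_interp M c
  | App f us => fn_interp M f (fun i => eval e (us i))
  end.

Fixpoint sat (V : Type) (phi : formula V) : (V -> M) -> Prop :=
  match phi with
  | Atom s us => fun e => rel_interp M s (fun i => eval e (us i))
  | Not p => fun e => ~ sat p e
  | And p q => fun e => sat p e /\ sat q e
  | Or p q => fun e => sat p e \/ sat q e
  | Imp p q => fun e => sat p e -> sat q e
  | Ex p => fun e => exists m : M, sat p (oapp e m)
  | All p => fun e => forall m : M, sat p (oapp e m)
  end.

Definition realization (V : Type) (phi : formula V) : set (V -> M) :=
  [set e | sat phi e].

Definition fn_graph (f : fn_sym L) : set ('I_(fn_arity f).+1 -> M) :=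
  [set y | fn_interp M f (fun i => y (widen_ord (leqnSn _) i)) = y ord_max].

End Syntax.
Arguments eval {L} M {V} e u.
Arguments sat {L} M {V} phi _.
Arguments realization {L} M {V} phi _.
Arguments fn_graph {L} M f _.

(* An element of (N^k)^n = N^{kn} is a map ['I_n * 'I_k -> N], the second index
   running over the coordinates of a point of N^k. *)
Record interp_formulas (L L' : language) := InterpFormulas {
  idim : nat;
  idom : formula L' 'I_idim;
  icst : cst_sym L -> formula L' 'I_idim;
  irel : forall s : rel_sym L, formula L' ('I_(rel_arity s) * 'I_idim);
  ifn : forall f : fn_sym L, formula L' ('I_(fn_arity f).+1 * 'I_idim) }.

Definition positive_existential_interp (L L' : language)
    (I : interp_formulas L L') : Prop :=
  [/\ positive_existential (idom I),
      forall c, positive_existential (icst I c),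
      forall s, positive_existential (irel I s) &
      forall f, positive_existential (ifn I f)].

Definition set_power (T : Type) (k : nat) (D : set ('I_k -> T)) (n : nat) :
    set ('I_n * 'I_k -> T) :=
  [set e | forall i, D (fun j => e (i, j))].

(* Preimage under theta^n : D^n -> M^n, as a subset of T^{kn}. *)
Definition power_preimage (T M : Type) (k : nat) (D : set ('I_k -> T))
    (theta : D -> M) (n : nat) (S : set ('I_n -> M)) :
    set ('I_n * 'I_k -> T) :=
  [set e | exists x : 'I_n -> D,
     S (fun i => theta (x i)) /\ e = fun ij => val (x ij.1) ij.2].

Definition interprets (L L' : language) (I : interp_formulas L L')
    (M : structure L) (N : structure L')
    (theta : realization N (idom I) -> M) : Prop :=
  let D := realization N (idom I) in
  [/\ set_surj setT setT theta,
      forall c, realization N (icst I c) `<=` D /\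
        [set val x | x in theta @^-1` [set cst_interp M c]] =
        realization N (icst I c),
      forall s, realization N (irel I s) `<=` @set_power N _ D _ /\
        power_preimage theta (rel_interp M s) = realization N (irel I s) &
      forall f, realization N (ifn I f) `<=` @set_power N _ D _ /\
        power_preimage theta (fn_graph M f) = realization N (ifn I f)].

Definition uniformly_pe_interpretable (L L' : language) (M : structure L)
    (NN : structure L' -> Prop) : Prop :=
  (exists N, NN N) /\
  exists I : interp_formulas L L', positive_existential_interp I /\
    forall N, NN N -> exists theta : realization N (idom I) -> M,
      interprets theta.

Variant ring_cst := Zero | One.
Variant ring_t_cst := Zero_t | One_t | T_t.
Variant ring_rel := Eq.
Variant ring_fn := Add | Mul.

Definition L_ring : language :=
  {| cst_sym := ring_cst;
     rel_sym := ring_rel; rel_arity := fun=> 2%N;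
     fn_sym := ring_fn; fn_arity := fun=> 2%N |}.

Definition L_t : language :=
  {| cst_sym := ring_t_cst;
     rel_sym := ring_rel; rel_arity := fun=> 2%N;
     fn_sym := ring_fn; fn_arity := fun=> 2%N |}.

Definition ring_rel_interp (A : Type) (s : ring_rel) : set ('I_2 -> A) :=
  match s with Eq => [set x | x ord0 = x ord_max] end.

Definition ring_fn_interp (A : pzRingType) (f : ring_fn) (x : 'I_2 -> A) : A :=
  match f with
  | Add => x ord0 + x ord_max
  | Mul => x ord0 * x ord_max
  end.

Definition ring_structure (A : pzRingType) : structure L_ring :=
  @Structure L_ring A
    (fun c => match c with Zero => 0 | One => 1 end)
    (@ring_rel_interp A) (@ring_fn_interp A).

Definition ring_t_structure (A : pzRingType) (t : A) : structure L_t :=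
  @Structure L_t A
    (fun c => match c with Zero_t => 0 | One_t => 1 | T_t => t end)
    (@ring_rel_interp A) (@ring_fn_interp A).

Definition fps (R : Type) : Type := nat -> R.

HB.instance Definition _ (R : Type) := gen_eqMixin (fps R).
HB.instance Definition _ (R : Type) := gen_choiceMixin (fps R).

Section PowerSeries.
Variable R : comNzRingType.
Implicit Types a b c : fps R.

Definition fps_zero : fps R := fun=> 0.
Definition fps_one : fps R := fun n => (n == 0)%:R.
Definition fps_opp a : fps R := fun n => - a n.
Definition fps_add a b : fps R := fun n => a n + b n.
Definition fps_mul a b : fps R := fun n => \sum_(i < n.+1) a i * b (n - i)%N.
Definition fps_X : fps R := fun n => (n == 1)%:R.

Fact fps_addA : associative fps_add.
Proof. by move=> a b c; apply/funext => n; apply: addrA. Qed.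

Fact fps_addC : commutative fps_add.
Proof. by move=> a b; apply/funext => n; apply: addrC. Qed.

Fact fps_add0 : left_id fps_zero fps_add.
Proof. by move=> a; apply/funext => n; apply: add0r. Qed.

Fact fps_addN : left_inverse fps_zero fps_opp fps_add.
Proof. by move=> a; apply/funext => n; apply: addNr. Qed.

HB.instance Definition _ :=
  GRing.isZmodule.Build (fps R) fps_addA fps_addC fps_add0 fps_addN.

Let trunc (N : nat) a : {poly R} := \poly_(i < N.+1) a i.

Let truncE N a n : (n <= N)%N -> (trunc N a)`_n = a n.
Proof. by move=> nN; rewrite coef_poly ltnS nN. Qed.

Let trunc_mul N a b n : (n <= N)%N -> (trunc N a * trunc N b)`_n = fps_mul a b n.
Proof.
move=> nN; rewrite coefM; apply: eq_bigr => i _.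
rewrite !truncE// ?(leq_trans (leq_subr _ _) nN)//.
by rewrite (leq_trans _ nN)// -ltnS.
Qed.

Fact fps_mulC : commutative fps_mul.
Proof.
by move=> a b; apply/funext => n; rewrite -!(trunc_mul _ _ (leqnn n)) mulrC.
Qed.

Fact fps_mulA : associative fps_mul.
Proof.
move=> a b c; apply/funext => n.
transitivity ((trunc n a * (trunc n b * trunc n c))`_n).
  rewrite coefM; apply: eq_bigr => i _.
  by rewrite trunc_mul ?leq_subr// truncE// -ltnS.
rewrite mulrA coefM; apply: eq_bigr => i _.
by rewrite trunc_mul -1?ltnS// truncE// leq_subr.
Qed.

Fact fps_mul1 : left_id fps_one fps_mul.
Proof.
move=> a; apply/funext => n; rewrite /fps_mul big_ord_recl /= mul1r subn0.
by rewrite big1 ?addr0// => i _; rewrite mul0r.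
Qed.

Fact fps_mulDl : left_distributive fps_mul fps_add.
Proof.
move=> a b c; apply/funext => n; rewrite /fps_mul /fps_add -big_split /=.
by apply: eq_bigr => i _; rewrite mulrDl.
Qed.

Fact fps_oner_neq0 : fps_one != 0 :> fps R.
Proof.
by apply/eqP => /(congr1 (fun a : fps R => a 0%N))/eqP; rewrite oner_eq0.
Qed.

HB.instance Definition _ := GRing.Zmodule_isComNzRing.Build (fps R)
  fps_mulA fps_mulC fps_mul1 fps_mulDl fps_oner_neq0.

End PowerSeries.

Record nonarch_absval (K : realType) (R : idomainType) := NonarchAbsval {
  absv :> R -> K;
  absv_ge0 : forall x, 0 <= absv x;
  absv_eq0 : forall x, absv x = 0 <-> x = 0;
  absvM : forall x y, absv (x * y) = absv x * absv y;
  absv_ultra : forall x y, absv (x + y) <= Num.max (absv x) (absv y) }.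

Section Entire.
Variables (K : realType) (R : idomainType) (v : nonarch_absval K R).

Definition is_entire : set (fps R) :=
  [set c | forall r : K, 0 < r -> v (c M) * r ^+ M @[M --> \oo] --> (0 : K)].

Fact absv0 : v 0 = 0. Proof. exact/absv_eq0. Qed.

Fact absv1 : v 1 = 1.
Proof.
have /eqP : v 1 * v 1 = v 1 * 1 by rewrite -absvM !mulr1.
have v1_neq0 : v 1 != 0.
  by apply/eqP => /absv_eq0 /eqP; rewrite oner_eq0.
by rewrite (inj_eq (mulfI v1_neq0)) => /eqP.
Qed.

Fact absvN x : v (- x) = v x.
Proof.
have vN1 : v (-1) = 1.
  apply/eqP; rewrite -(@eqrXn2 _ 2)//; last exact: absv_ge0.
  by rewrite expr2 -absvM mulrNN mulr1 absv1 expr1n.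
by rewrite -mulN1r absvM vN1 mul1r.
Qed.

Fact is_entireP (c : fps R) :
  is_entire c <->
  forall r : K, 0 < r -> exists C, forall n, v (c n) * r ^+ n <= C.
Proof.
split=> [cE r r0|cB r r0].
  have /cvgP/cvg_seq_bounded[C [_ CP]] := cE r r0.
  exists (C + 1) => n; apply: le_trans (ler_norm _) _.
  by apply: CP => //; rewrite ltrDl.
have [C CP] := cB (2 * r) (mulr_gt0 (ltr0Sn K 1) r0).
apply: (@squeeze_cvgr _ _ _ _ (cst 0) (fun n => C * (2^-1) ^+ n)).
- near=> n; rewrite mulr_ge0 ?absv_ge0 ?exprn_ge0 ?(ltW r0)//=.
  rewrite exprVn ler_pdivlMr ?exprn_gt0// -mulrA -exprMn (mulrC r).
  exact: CP.
- exact: cvg_cst.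
- rewrite -[X in _ --> X](mulr0 C); apply: cvgM; first exact: cvg_cst.
  by apply: cvg_expr; rewrite ger0_norm ?invr_ge0// invf_lt1// ltr1n.
Unshelve. all: by end_near. Qed.

Definition entire_pred : {pred fps R} := mem is_entire.

Fact entire_subring_closed : subring_closed entire_pred.
Proof.
split=> [|a b|a b].
- apply/mem_set/is_entireP => r r0; exists 1 => n.
  rewrite /GRing.one /= /fps_one; case: n => [|n] /=.
    by rewrite absv1 mulr1.
  by rewrite absv0 mul0r.
- move=> /set_mem/is_entireP aE /set_mem/is_entireP bE.
  apply/mem_set/is_entireP => r r0.
  have [A AP] := aE r r0; have [B BP] := bE r r0.
  exists (Num.max A B) => n.
  have rn0 : 0 <= r ^+ n by rewrite exprn_ge0// ltW.
  apply: le_trans (ler_wpM2r rn0 (absv_ultra _ _ _)) _.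
  by rewrite maxr_pMl// absvN ge_max !le_max AP BP orbT.
- move=> /set_mem/is_entireP aE /set_mem/is_entireP bE.
  apply/mem_set/is_entireP => r r0.
  have [A AP] := aE r r0; have [B BP] := bE r r0.
  exists (A * B) => n.
  have r0' m : 0 <= r ^+ m by rewrite exprn_ge0// ltW.
  have AB0 : 0 <= A * B.
    by rewrite mulr_ge0// (le_trans _ (AP 0%N), le_trans _ (BP 0%N))//
      mulr_ge0 ?absv_ge0.
  rewrite -ler_pdivlMr ?exprn_gt0//.
  have D0 : 0 <= A * B / r ^+ n by rewrite divr_ge0.
  apply: (big_ind (fun x => v x <= A * B / r ^+ n)).
  + by rewrite absv0.
  + move=> x y xD yD; apply: le_trans (absv_ultra _ _ _) _.
    by rewrite ge_max xD yD.
  + move=> i _; rewrite absvM ler_pdivlMr ?exprn_gt0//.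
    have -> : r ^+ n = r ^+ i * r ^+ (n - i).
      by rewrite -exprD subnKC// -ltnS.
    by rewrite mulrACA; apply: ler_pM; rewrite ?mulr_ge0 ?absv_ge0.
Qed.

Fact fps_X_entire : fps_X R \in entire_pred.
Proof.
apply/mem_set/is_entireP => r r0; exists r => n; rewrite /fps_X.
case: n => [|[|n]] /=; first by rewrite absv0 mul0r ltW.
  by rewrite absv1 mul1r.
by rewrite absv0 mul0r ltW.
Qed.

HB.instance Definition _ :=
  GRing.isSubringClosed.Build (fps R) entire_pred entire_subring_closed.

Record entire := Entire {
  entire_series :> fps R;
  entire_seriesP : entire_series \in entire_pred }.

HB.instance Definition _ := [isSub for entire_series].
HB.instance Definition _ := [Choice of entire by <:].
HB.instance Definition _ := [SubChoice_isSubComNzRing of entire by <:].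

Definition entire_X : entire := Entire fps_X_entire.

Definition entire_structure : structure L_t := ring_t_structure entire_X.

End Entire.

Inductive entire_pos_char (K : realType) : structure L_t -> Prop :=
| EntirePosChar (R : idomainType) (v : nonarch_absval K R) (p : nat) of
    p \in [pchar R] : entire_pos_char K (entire_structure v).

(* Main.v *)
From HB Require Import structures.
Require Import Defs.
From mathcomp Require Import all_boot all_order all_algebra.
From mathcomp Require Import all_classical all_reals all_analysis.
From mathcomp Require Import generic_quotient separable cyclic.
From mathcomp Require Import ring lra zify.

Set Implicit Arguments.
Unset Strict Implicit.
Unset Printing Implicit Defensive.
Import Order.TTheory GRing.Theory Num.Theory.
Import numFieldNormedType.Exports.

Local Open Scope ring_scope.

(** Let A be the ring of entire functions over R, of characteristic p, and let
    B = A[u] be its quadratic extension by u + 1/u = t, with the conjugation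
    that exchanges u and 1/u.  An element x + y u of B is a pair (x, y) of
    elements of A, and the integer n is coded by u^n.  Addition of integers is
    then multiplication in B, and everything rests on three facts about B.

    The first is that the powers of u are definable.  They are the elements a
    of norm 1 such that u - 1 divides a - 1.  Norm 1 is a Pell equation
    x^2 + t x y + y^2 = 1, and [pell] shows that its entire solutions are
    the elements u^n and - u^n.  The point is that they are polynomials.  Seen
    as a function of u, the element a has on each circle of radius r >= 1 a
    multiplicative norm [unorm], and log [unorm] is a convex function of log r,
    as always for a maximum of terms v(a_i) r^i.  Since the conjugate of a is its
    inverse, log [unorm] is concave as well, hence affine, so that a grows like a
    power of r and has polynomial coefficients ([pell_quad_poly]).  For
    polynomials, multiplying by u or by 1/u lowers the degrees ([pell_poly]).

    The second is that divisibility of exponents is divisibility of u^n - 1 by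
    u^m - 1 ([exp_dvd_upow]), while divisibility by the square of u^m - 1 holds
    when n = m p^s with s > 0 and excludes n = m and n = - m.

    The third is that m = n p^s can almost be recognized.  In characteristic
    p <> 2 the polynomial 1 + x^(n p^s) is the power (1 + x^n)^(p^s), with an odd
    exponent, and 1 + x^n has only simple roots when p does not divide n.
    Therefore (1 + u^m)(1 + u^n) is a square when m = n p^s, and conversely it is
    a square only if m and n have the same prime-to-p part up to sign.  For p = 2
    one uses cubes and 1 + x + x^2 instead, since 2^s is never divisible by 3.
    The prime p enters the resulting formula [exp_sim] only through the
    alternative between 1/2 being in A and 2 being 0 in A, so that the formula
    does not depend on p.

    From there on the argument is about integers.  With [exp_sim] one defines
    the numbers q = p^s, up to sign, and then, for large q, the pairs (q, q^2),
    because q^2 - q and q - 1 differ by the factor q.  If q - a divides q^2 - b,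
    then it divides a^2 - b, whence b = a^2 as soon as q is large.  That q is large compared with a is
    expressed by saying that the nonzero number 11 (2 a + 1) divides some
    difference p^j - p^i with i < j and p^j dividing q; every nonzero integer
    divides a difference of this kind.  Squares give products, by
    (a + b)^2 = a^2 + b^2 + 2 a b. *)

(** * The quadratic extension by u with u + 1/u = t *)

(** The element [Quad x y] stands for x + y u, where u^2 = t u - 1.  Keeping
    the base ring general gives at once the extensions of the polynomials, where
    t is ['X], and of the entire functions. *)
Record quad (S : comNzRingType) (t : S) := Quad { qre : S; qim : S }.

HB.instance Definition _ (S : comNzRingType) (t : S) := gen_eqMixin (quad t).
HB.instance Definition _ (S : comNzRingType) (t : S) := gen_choiceMixin (quad t).

Section QuadRing.
Variables (S : comNzRingType) (t : S).
Implicit Types a b : quad t.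

Definition quad_add a b := Quad t (qre a + qre b) (qim a + qim b).
Definition quad_opp a := Quad t (- qre a) (- qim a).
Definition quad_mul a b :=
  Quad t (qre a * qre b - qim a * qim b)
    (qre a * qim b + qim a * qre b + t * (qim a * qim b)).

Fact quad_addA : associative quad_add.
Proof. by move=> [? ?] [? ?] [? ?]; congr Quad; rewrite /= addrA. Qed.
Fact quad_addC : commutative quad_add.
Proof. by move=> [? ?] [? ?]; congr Quad; rewrite /= addrC. Qed.
Fact quad_add0 : left_id (Quad t 0 0) quad_add.
Proof. by move=> [? ?]; congr Quad; rewrite /= add0r. Qed.
Fact quad_addN : left_inverse (Quad t 0 0) quad_opp quad_add.
Proof. by move=> [? ?]; congr Quad; rewrite /= addNr. Qed.

HB.instance Definition _ :=
  GRing.isZmodule.Build (quad t) quad_addA quad_addC quad_add0 quad_addN.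

Fact quad_mulA : associative quad_mul.
Proof. by move=> [? ?] [? ?] [? ?]; congr Quad => /=; ring. Qed.
Fact quad_mulC : commutative quad_mul.
Proof. by move=> [? ?] [? ?]; congr Quad => /=; ring. Qed.
Fact quad_mul1 : left_id (Quad t 1 0) quad_mul.
Proof. by move=> [? ?]; congr Quad => /=; ring. Qed.
Fact quad_mulDl : left_distributive quad_mul quad_add.
Proof. by move=> [? ?] [? ?] [? ?]; congr Quad => /=; ring. Qed.
Fact quad_oner_neq0 : Quad t 1 0 != Quad t 0 0.
Proof. by apply/eqP => -[] /eqP; rewrite oner_eq0. Qed.

HB.instance Definition _ := GRing.Zmodule_isComNzRing.Build (quad t)
  quad_mulA quad_mulC quad_mul1 quad_mulDl quad_oner_neq0.

Definition qconst (c : S) : quad t := Quad t c 0.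
Definition qgen : quad t := Quad t 0 1.
Definition qconj a : quad t := Quad t (qre a + t * qim a) (- qim a).

Fact qconst_zmod : zmod_morphism qconst.
Proof. by move=> c d; congr Quad => /=; rewrite subrr. Qed.
Fact qconst_monoid : monoid_morphism qconst.
Proof. by split=> // c d; congr Quad => /=; ring. Qed.
HB.instance Definition _ := GRing.isZmodMorphism.Build S (quad t) qconst qconst_zmod.
HB.instance Definition _ := GRing.isMonoidMorphism.Build S (quad t) qconst qconst_monoid.

Fact qconj_zmod : zmod_morphism qconj.
Proof. by move=> [? ?] [? ?]; congr Quad => /=; ring. Qed.
Fact qconj_monoid : monoid_morphism qconj.
Proof. by split=> [|[? ?] [? ?]]; congr Quad => /=; ring. Qed.
HB.instance Definition _ :=
  GRing.isZmodMorphism.Build (quad t) (quad t) qconj qconj_zmod.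
HB.instance Definition _ :=
  GRing.isMonoidMorphism.Build (quad t) (quad t) qconj qconj_monoid.

Lemma qconjM a b : qconj (a * b) = qconj a * qconj b.
Proof. exact: rmorphM. Qed.
Lemma qconjN a : qconj (- a) = - qconj a.
Proof. exact: rmorphN. Qed.
Lemma qconjB a b : qconj (a - b) = qconj a - qconj b.
Proof. exact: rmorphB. Qed.
Lemma qconjX a n : qconj (a ^+ n) = qconj a ^+ n.
Proof. exact: rmorphXn. Qed.
Lemma qconj1 : qconj 1 = 1.
Proof. exact: rmorph1. Qed.

Lemma qconjK : involutive qconj.
Proof. by move=> [? ?]; congr Quad => /=; ring. Qed.

Lemma qconj_const c : qconj (qconst c) = qconst c.
Proof. by congr Quad => /=; ring. Qed.

Lemma quadE a : a = qconst (qre a) + qconst (qim a) * qgen.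
Proof. by case: a => ? ?; congr Quad => /=; ring. Qed.

Lemma qgen_conj : qgen * qconj qgen = 1.
Proof. by congr Quad => /=; ring. Qed.

Lemma mul_qgen x y : Quad t x y * qgen = Quad t (- y) (x + t * y).
Proof. by congr Quad => /=; ring. Qed.

Lemma mul_conj_qgen x y : Quad t x y * qconj qgen = Quad t (y + t * x) (- x).
Proof. by congr Quad => /=; ring. Qed.

(** This recovers the coefficient of u from an element and its conjugate, and
    is how bounds on both become bounds on the coefficients. *)
Lemma sub_qconj a : a - qconj a = qconst (qim a) * (qgen - qconj qgen).
Proof. by case: a => ? ?; congr Quad => /=; ring. Qed.

Definition qpow (n : int) : quad t :=
  match n with Posz k => qgen ^+ k | Negz k => qconj qgen ^+ k.+1 end.

Lemma qpow_conj n : qconj (qpow n) = qpow (- n).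
Proof.
case: n => [[|k]|k] /=; rewrite ?rmorph1 ?oppr0 ?rmorphXn //=.
by rewrite qconjK.
Qed.

Lemma qpow_subn (m n : nat) : qgen ^+ m * qconj qgen ^+ n = qpow (m%:Z - n%:Z).
Proof.
case: (leqP n m) => [nm|mn].
  rewrite -{1}(subnK nm) exprD -mulrA -exprMn qgen_conj expr1n mulr1.
  by rewrite subzn.
rewrite -{1}(subnK (ltnW mn)) exprD mulrCA -exprMn qgen_conj expr1n mulr1.
rewrite -[_ - _]opprK opprB subzn ?(ltnW mn)//.
by rewrite -qpow_conj /= rmorphXn.
Qed.

Lemma qpowD m n : qpow (m + n) = qpow m * qpow n.
Proof.
case: m n => [m|m] [n|n].
- by rewrite /= exprD.
- by rewrite NegzE -qpow_subn.
- by rewrite addrC mulrC NegzE -qpow_subn.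
- by rewrite /= -exprD addSn addnS.
Qed.

Lemma qpow0 : qpow 0 = 1. Proof. by []. Qed.
Lemma qpow1 : qpow 1 = qgen. Proof. by []. Qed.

Lemma qpowN n : qpow n * qpow (- n) = 1.
Proof. by rewrite -qpowD subrr. Qed.

Lemma qpowXn n k : qpow n ^+ k = qpow (n * k%:Z).
Proof.
elim: k => [|k IH]; first by rewrite mulr0.
by rewrite exprS IH -qpowD intS mulrDr mulr1.
Qed.

End QuadRing.

(** * Gauss norms of polynomials *)

Section GaussNorm.
Variables (K : realType) (R : idomainType) (v : nonarch_absval K R).
Implicit Types (r : K) (P Q : {poly R}).

Lemma absv_gt0 x : (0 < v x) = (x != 0).
Proof.
rewrite lt0r absv_ge0 andbT; congr (~~ _).
by apply/idP/idP => /eqP xE; apply/eqP; apply/(absv_eq0 v).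
Qed.

Lemma absv_dom x y : v y < v x -> v (x + y) = v x.
Proof.
move=> yx; apply/eqP; rewrite eq_le; apply/andP; split.
  by apply: le_trans (absv_ultra _ _ _) _; rewrite ge_max lexx ltW.
rewrite leNgt; apply/negP => xyx.
have := absv_ultra v (x + y) (- y).
by rewrite addrK absvN leNgt gt_max xyx yx.
Qed.

Definition gauss r P : K := \big[Num.max/0]_(i < size P) (v P`_i * r ^+ i).

Lemma gauss_ge0 r P : 0 <= gauss r P.
Proof. by rewrite /gauss; elim/big_rec: _ => // i x _ x0; rewrite le_max x0 orbT. Qed.

Lemma gauss_ge r P i : v P`_i * r ^+ i <= gauss r P.
Proof.
case: (ltnP i (size P)) => iP; last first.
  by rewrite nth_default// absv0 mul0r gauss_ge0.
exact: (le_bigmax _ (fun i : 'I_(size P) => v P`_i * r ^+ i) (Ordinal iP)).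
Qed.

Lemma gauss_le r P C :
  0 <= C -> (forall i, v P`_i * r ^+ i <= C) -> gauss r P <= C.
Proof. by move=> C0 PC; apply: bigmax_le => // i _; apply: PC. Qed.

Lemma gauss0 r : gauss r 0 = 0.
Proof. by rewrite /gauss size_poly0 big_ord0. Qed.

Lemma gaussC r c : gauss r c%:P = v c.
Proof.
apply/eqP; rewrite eq_le; apply/andP; split.
  apply: gauss_le => [|i]; first exact: absv_ge0.
  by rewrite coefC; case: i => [|i] /=; rewrite ?mulr1// absv0 mul0r absv_ge0.
by have := gauss_ge r c%:P 0; rewrite coefC mulr1.
Qed.

Section Radius.
Variables (r : K) (r0 : 0 < r).

Lemma gauss_arg P : P != 0 -> exists i, v P`_i * r ^+ i == gauss r P.
Proof.
move=> P0; have Pgt0 : 0 < gauss r P.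
  apply: lt_le_trans (gauss_ge r P (size P).-1).
  by rewrite mulr_gt0 ?exprn_gt0// absv_gt0 -lead_coefE lead_coef_eq0.
apply: contrapT => nP; have : gauss r P < gauss r P.
  apply: bigmax_lt => // i _; rewrite lt_neqAle gauss_ge andbT.
  by apply/negP => iP; apply: nP; exists i.
by rewrite ltxx.
Qed.

Lemma gauss_gt0 P : P != 0 -> 0 < gauss r P.
Proof.
move=> P0; apply: lt_le_trans (gauss_ge r P (size P).-1).
by rewrite mulr_gt0 ?exprn_gt0// absv_gt0 -lead_coefE lead_coef_eq0.
Qed.

Lemma gauss_eq0 P : gauss r P = 0 -> P = 0.
Proof.
by move=> P0; apply/eqP/negPn/negP => /gauss_gt0; rewrite P0 ltxx.
Qed.

Lemma gaussD P Q : gauss r (P + Q) <= Num.max (gauss r P) (gauss r Q).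
Proof.
apply: gauss_le => [|i]; first by rewrite le_max gauss_ge0.
have ri : 0 <= r ^+ i by rewrite exprn_ge0// ltW.
rewrite coefD; apply: le_trans (ler_wpM2r ri (absv_ultra _ _ _)) _.
by rewrite maxr_pMl// ge_max !le_max !gauss_ge orbT.
Qed.

Lemma gaussN P : gauss r (- P) = gauss r P.
Proof.
have le Q : gauss r (- Q) <= gauss r Q.
  by apply: gauss_le (gauss_ge0 r Q) _ => i; rewrite coefN absvN gauss_ge.
by apply/eqP; rewrite eq_le le -{1}[P]opprK le.
Qed.

Lemma gaussM_le P Q : gauss r (P * Q) <= gauss r P * gauss r Q.
Proof.
have C0 : 0 <= gauss r P * gauss r Q by rewrite mulr_ge0 ?gauss_ge0.
apply: gauss_le => // k; rewrite coefM.
apply: (big_ind (fun x => v x * r ^+ k <= gauss r P * gauss r Q)).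
- by rewrite absv0 mul0r.
- move=> x y xC yC; have rk : 0 <= r ^+ k by rewrite exprn_ge0// ltW.
  apply: le_trans (ler_wpM2r rk (absv_ultra _ _ _)) _.
  by rewrite maxr_pMl// ge_max xC yC.
- move=> i _; have -> : r ^+ k = r ^+ i * r ^+ (k - i).
    by rewrite -exprD subnKC// -ltnS.
  by rewrite absvM mulrACA ler_pM ?mulr_ge0 ?absv_ge0 ?exprn_ge0 ?(ltW r0)// gauss_ge.
Qed.

(** Gauss's lemma: the product of the first dominant terms of the factors
    is the only dominant contribution to its coefficient. *)
Lemma gaussM P Q : gauss r (P * Q) = gauss r P * gauss r Q.
Proof.
have [->|P0] := eqVneq P 0; first by rewrite mul0r gauss0 mul0r.
have [->|Q0] := eqVneq Q 0; first by rewrite mulr0 gauss0 mulr0.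
apply/eqP; rewrite eq_le gaussM_le /=.
have gP := gauss_gt0 P0; have gQ := gauss_gt0 Q0.
have /ex_minnP[i /eqP iP imin] := gauss_arg P0.
have /ex_minnP[j /eqP jQ jmin] := gauss_arg Q0.
have rk0 m : 0 < r ^+ m by rewrite exprn_gt0.
have lt_i k : (k < i)%N -> v P`_k * r ^+ k < gauss r P.
  move=> ki; rewrite lt_neqAle gauss_ge andbT; apply/negP => /imin.
  by rewrite leqNgt ki.
have lt_j k : (k < j)%N -> v Q`_k * r ^+ k < gauss r Q.
  move=> kj; rewrite lt_neqAle gauss_ge andbT; apply/negP => /jmin.
  by rewrite leqNgt kj.
have iij : (i < (i + j).+1)%N by rewrite ltnS leq_addr.
apply: le_trans (gauss_ge r _ (i + j)).
rewrite coefM (bigD1 (Ordinal iij)) //= addKn.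
rewrite absv_dom; first by rewrite absvM exprD mulrACA iP jQ.
rewrite -(ltr_pM2r (rk0 (i + j)%N)) absvM exprD mulrACA iP jQ -exprD.
apply: (big_ind (fun x => v x * r ^+ (i + j) < gauss r P * gauss r Q)).
- by rewrite absv0 mul0r mulr_gt0.
- move=> x y xC yC; have rk : 0 <= r ^+ (i + j) by rewrite ltW.
  apply: le_lt_trans (ler_wpM2r rk (absv_ultra _ _ _)) _.
  by rewrite maxr_pMl// gt_max xC yC.
- move=> k; rewrite -val_eqE /= => ki.
  have kij : (k <= i + j)%N by rewrite -ltnS.
  have -> : r ^+ (i + j) = r ^+ k * r ^+ (i + j - k) by rewrite -exprD subnKC.
  rewrite absvM mulrACA; case: (ltngtP k i) ki => // ki _.
    apply: le_lt_trans (_ : _ <= v P`_k * r ^+ k * gauss r Q) _.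
      by rewrite ler_wpM2l ?gauss_ge// mulr_ge0 ?absv_ge0// ltW.
    by rewrite ltr_pM2r// lt_i.
  apply: le_lt_trans (_ : _ <= gauss r P * (v Q`_(i + j - k) * r ^+ (i + j - k))) _.
    by rewrite ler_wpM2r ?gauss_ge// mulr_ge0 ?absv_ge0// ltW.
  by rewrite ltr_pM2l// lt_j// -(ltn_add2l k) subnKC// ltn_add2r.
Qed.

Lemma gaussX : gauss r 'X = r.
Proof.
apply/eqP; rewrite eq_le; apply/andP; split.
  apply: gauss_le => [|i]; first exact: ltW.
  rewrite coefX; case: eqP => [->|_] /=; first by rewrite absv1 mul1r.
  by rewrite absv0 mul0r ltW.
by have := gauss_ge r 'X 1; rewrite coefX absv1 mul1r.
Qed.

End Radius.

(** Each term v(a_i) r^i is a log-linear function of r, so that their maximum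
    is log-convex; this is the case of the radii 1, r and r^2. *)
Lemma gauss_convex r P : gauss r P ^+ 2 <= gauss 1 P * gauss (r ^+ 2) P.
Proof.
rewrite -(@sqr_sqrtr _ (gauss 1 P * gauss (r ^+ 2) P)) ?mulr_ge0 ?gauss_ge0//.
rewrite lerXn2r ?nnegrE ?gauss_ge0 ?sqrtr_ge0//.
apply: gauss_le => [|i]; first exact: sqrtr_ge0.
case: (leP 0 (v P`_i * r ^+ i)) => [Pi|Pi]; last first.
  by rewrite (le_trans (ltW Pi))// sqrtr_ge0.
rewrite -(ger0_norm Pi) -sqrtr_sqr ler_wsqrtr// exprMn exprAC.
rewrite [X in X * _]expr2 -mulrA ler_pM ?absv_ge0//.
- by rewrite mulr_ge0 ?absv_ge0// exprn_ge0// sqr_ge0.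
- by have := gauss_ge 1 P i; rewrite expr1n mulr1.
- exact: gauss_ge.
Qed.

End GaussNorm.

(** * Gauss norms of Laurent polynomials in u *)

Local Notation "x %:F" := (@FracField.tofrac _ x).

Section FractionRatio.
Local Open Scope quotient_scope.

(** Numerator and denominator come as one pair, so that a single choice
    defines the norm of a fraction. *)
Lemma fraction_ratio (D : idomainType) (x : {fraction D}) :
  exists nd : D * D, nd.2 != 0 /\ x * nd.2%:F = nd.1%:F.
Proof.
elim/quotW: x => y; exists (fraction.frac y); split=> /=; first exact: denom_ratioP.
unlock FracField.tofrac; rewrite -[LHS]FracField.pi_mul.
apply/eqmodP => /=; rewrite FracField.equivfE /FracField.mulf.
by rewrite !numden_Ratio ?oner_eq0 ?mulf_neq0 ?oner_neq0 ?denom_ratioP// !mulr1 mulrC.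
Qed.

End FractionRatio.

Section FractionNorm.
Variables (K : realType) (R : idomainType) (v : nonarch_absval K R).
Variables (r : K) (r0 : 0 < r).
Implicit Types (x y : {fraction {poly R}}).

Definition fnorm x : K :=
  let nd := sval (cid (fraction_ratio x)) in gauss v r nd.1 / gauss v r nd.2.

(** Any presentation as a quotient computes the norm, by multiplicativity. *)
Lemma fnormE x (n d : {poly R}) : d != 0 -> x * d%:F = n%:F ->
  fnorm x = gauss v r n / gauss v r d.
Proof.
rewrite /fnorm; case: cid => -[n' d'] /= [d'0 xd'] d0 xd.
have gd := lt0r_neq0 (gauss_gt0 v r0 d0).
have gd' := lt0r_neq0 (gauss_gt0 v r0 d'0).
have /eqP : (n' * d)%:F = (n * d')%:F :> {fraction {poly R}}.
  by rewrite !rmorphM /= -xd -xd' mulrAC.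
rewrite tofrac_eq => /eqP /(congr1 (gauss v r)); rewrite !gaussM// => E.
by apply/eqP; rewrite eqr_div// E.
Qed.

Lemma fnorm_tofrac (P : {poly R}) : fnorm P%:F = gauss v r P.
Proof.
rewrite (@fnormE _ P 1) ?oner_neq0 ?rmorph1 ?mulr1//.
by rewrite gaussC absv1 divr1.
Qed.

Lemma fnormM x y : fnorm (x * y) = fnorm x * fnorm y.
Proof.
have [[n d] /= [d0 xd]] := fraction_ratio x.
have [[m e] /= [e0 ye]] := fraction_ratio y.
rewrite (fnormE d0 xd) (fnormE e0 ye) (@fnormE _ (n * m) (d * e)) ?mulf_neq0//.
  by rewrite !gaussM// invfM mulrACA.
by rewrite !rmorphM /= mulrACA xd ye.
Qed.

Lemma fnormD x y : fnorm (x + y) <= Num.max (fnorm x) (fnorm y).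
Proof.
have [[n d] /= [d0 xd]] := fraction_ratio x.
have [[m e] /= [e0 ye]] := fraction_ratio y.
have de0 : d * e != 0 by rewrite mulf_neq0.
have gde : 0 <= (gauss v r (d * e))^-1 by rewrite invr_ge0 gauss_ge0.
rewrite (@fnormE x (n * e) (d * e))//; last by rewrite !rmorphM /= mulrA xd.
rewrite (@fnormE y (m * d) (d * e))//; last by rewrite mulrC !rmorphM /= -ye; ring.
rewrite (@fnormE _ (n * e + m * d) (d * e))//.
  by rewrite -maxr_pMl// ler_wpM2r// gaussD.
by rewrite rmorphD !rmorphM /= -xd -ye; ring.
Qed.

Lemma fnorm_ge0 x : 0 <= fnorm x.
Proof. by rewrite divr_ge0 ?gauss_ge0. Qed.

Lemma fnormN x : fnorm (- x) = fnorm x.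
Proof.
have [[n d] /= [d0 xd]] := fraction_ratio x.
by rewrite (fnormE d0 xd) (@fnormE _ (- n) d) ?gaussN// mulNr xd rmorphN.
Qed.

Lemma fnorm_eq0 x : fnorm x = 0 -> x = 0.
Proof.
have [[n d] /= [d0 xd]] := fraction_ratio x.
rewrite (fnormE d0 xd) => /eqP; rewrite mulf_eq0 invr_eq0.
rewrite (gt_eqF (gauss_gt0 v r0 d0)) orbF => /eqP /(gauss_eq0 r0) n0.
move: xd; rewrite n0 rmorph0 => /eqP; rewrite mulf_eq0 tofrac_eq0 (negbTE d0).
by rewrite orbF => /eqP.
Qed.

Lemma fnorm0 : fnorm 0 = 0.
Proof. by rewrite -[0](tofrac0 {poly R}) fnorm_tofrac gauss0. Qed.

Lemma fnorm_dom x y : fnorm y < fnorm x -> fnorm (x + y) = fnorm x.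
Proof.
move=> yx; apply/eqP; rewrite eq_le; apply/andP; split.
  by apply: le_trans (fnormD _ _) _; rewrite ge_max lexx ltW.
rewrite leNgt; apply/negP => xyx.
have := fnormD (x + y) (- y).
by rewrite addrK fnormN leNgt gt_max xyx yx.
Qed.

Lemma fnorm1 : fnorm 1 = 1.
Proof. by rewrite -(rmorph1 (@FracField.tofrac _)) fnorm_tofrac gaussC absv1. Qed.

End FractionNorm.

Section Laurent.
Variable R : idomainType.
Notation L := {fraction {poly R}}.

Definition lX : L := ('X : {poly R})%:F.
(** The variable X plays the role of u, so that t becomes X + 1/X. *)
Definition lT : L := lX + lX^-1.

Lemma lX_neq0 : lX != 0.
Proof. by rewrite tofrac_eq0 polyX_eq0. Qed.


Definition lconst (c : R) : L := (c%:P)%:F.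
Fact lconst_zmod : zmod_morphism lconst.
Proof. by move=> a b; rewrite /lconst !rmorphB. Qed.
Fact lconst_monoid : monoid_morphism lconst.
Proof. by split=> [|a b]; rewrite /lconst ?rmorph1 ?rmorphM. Qed.
HB.instance Definition _ := GRing.isZmodMorphism.Build R L lconst lconst_zmod.
HB.instance Definition _ := GRing.isMonoidMorphism.Build R L lconst lconst_monoid.

Definition leval (P : {poly R}) : L := (map_poly lconst P).[lT].
Fact leval_zmod : zmod_morphism leval.
Proof. by move=> a b; rewrite /leval rmorphB hornerD hornerN. Qed.
Fact leval_monoid : monoid_morphism leval.
Proof. by split=> [|a b]; rewrite /leval ?rmorph1 ?hornerE// rmorphM hornerM. Qed.
HB.instance Definition _ := GRing.isZmodMorphism.Build {poly R} L leval leval_zmod.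
HB.instance Definition _ :=
  GRing.isMonoidMorphism.Build {poly R} L leval leval_monoid.

Lemma levalX : leval 'X = lT.
Proof. by rewrite /leval map_polyX hornerX. Qed.
Lemma levalC c : leval c%:P = lconst c.
Proof. by rewrite /leval map_polyC hornerC. Qed.

Notation Q := (quad ('X : {poly R})).

Definition lquad (a : Q) : L := leval (qre a) + leval (qim a) * lX.
Fact lquad_zmod : zmod_morphism lquad.
Proof. by move=> [? ?] [? ?]; rewrite /lquad /= !raddfB; ring. Qed.
Fact lquad_monoid : monoid_morphism lquad.
Proof.
split=> [|[a b] [c d]]; first by rewrite /lquad /= rmorph0 rmorph1 mul0r addr0.
rewrite /lquad /= !raddfD /= raddfN !rmorphM /= levalX /lT.
have : lX * lX^-1 = 1 by rewrite divff// lX_neq0.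
set x := lX; set y := lX^-1 => xy.
rewrite [RHS](_ : _ = leval a * leval c - (x * y) * (leval b * leval d) +
  (leval a * leval d + leval b * leval c + (x + y) * (leval b * leval d)) * x).
  by rewrite xy mul1r rmorphM.
by ring.
Qed.
HB.instance Definition _ := GRing.isZmodMorphism.Build Q L lquad lquad_zmod.
HB.instance Definition _ := GRing.isMonoidMorphism.Build Q L lquad lquad_monoid.

Lemma lquad_u : lquad (qgen 'X) = lX.
Proof. by rewrite /lquad /= rmorph0 rmorph1 mul1r add0r. Qed.

Lemma lquad_conj_u : lquad (qconj (qgen 'X)) = lX^-1.
Proof.
apply: (mulfI lX_neq0); rewrite divff ?lX_neq0// -{1}lquad_u.
by rewrite -rmorphM qgen_conj rmorph1.
Qed.

(** Multiplying by a power of X turns X + 1/X into a polynomial. *)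
Lemma leval_laurent P : exists D (G : {poly R}), leval P * lX ^+ D = G%:F.
Proof.
elim/poly_ind: P => [|P c [D [G PG]]].
  exists 0%N; exists 0; by rewrite !rmorph0 mul0r.
exists D.+1, (G * ('X ^+ 2 + 1) + c%:P * 'X ^+ D.+1).
rewrite !rmorphD !rmorphM /= rmorphD rmorphXn rmorph1 rmorphXn /= -/lX -PG levalX levalC.
have : lX * lX^-1 = 1 by rewrite divff// lX_neq0.
rewrite /lT exprS; set x := lX; set y := lX^-1 => xy.
rewrite -/(lconst c); move: (x ^+ D) (leval P) (lconst c) => z p k.
rewrite [LHS](_ : _ = p * z * (x ^+ 2 + x * y) + k * (x * z)); last by ring.
by rewrite xy.
Qed.

Lemma lquad_laurent a : exists D (G : {poly R}), lquad a * lX ^+ D = G%:F.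
Proof.
case: a => a b; rewrite /lquad /=.
have [D [G aG]] := leval_laurent a; have [E [H bH]] := leval_laurent b.
exists (D + E)%N, (G * 'X ^+ E + H * 'X ^+ D * 'X).
rewrite !rmorphD !rmorphM /= !rmorphXn /= -/lX -aG -bH exprD.
by ring.
Qed.

End Laurent.

Section LaurentNorm.
Variables (K : realType) (R : idomainType) (v : nonarch_absval K R).
Notation L := {fraction {poly R}}.
Implicit Types (r : K).

Lemma fnorm_lX r : 0 < r -> fnorm v r (lX R) = r.
Proof. by move=> r0; rewrite fnorm_tofrac// gaussX. Qed.

Lemma fnormV r (x : L) : 0 < r -> x != 0 -> fnorm v r x^-1 = (fnorm v r x)^-1.
Proof.
move=> r0 x0; have wx : fnorm v r x != 0.
  by apply: contra x0 => /eqP/(fnorm_eq0 r0) ->.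
by apply: (mulfI wx); rewrite -fnormM// !divff// fnorm1.
Qed.

Lemma fnormX r (x : L) n : 0 < r -> fnorm v r (x ^+ n) = fnorm v r x ^+ n.
Proof.
by move=> r0; elim: n => [|n IH]; rewrite ?fnorm1// !exprS fnormM// IH.
Qed.

Lemma fnorm_lconst r c : 0 < r -> fnorm v r (lconst c) = v c.
Proof. by move=> r0; rewrite fnorm_tofrac// gaussC. Qed.


Lemma fnorm_lT r : 1 <= r -> fnorm v r (lT R) <= r.
Proof.
move=> r1; have r0 : 0 < r by apply: lt_le_trans r1.
apply: le_trans (fnormD _ r0 _ _) _.
rewrite fnormV ?lX_neq0// fnorm_lX// ge_max lexx /=.
by apply: (le_trans _ r1); rewrite invf_le1.
Qed.

Lemma fnorm_sum r (I : Type) (s : seq I) (F : I -> L) C : 0 < r -> 0 <= C ->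
  (forall i, fnorm v r (F i) <= C) -> fnorm v r (\sum_(i <- s) F i) <= C.
Proof.
move=> r0 C0 FC; apply: (big_ind (fun x => fnorm v r x <= C)) => //.
  by rewrite fnorm0.
by move=> x y xC yC; apply: le_trans (fnormD _ r0 _ _) _; rewrite ge_max xC yC.
Qed.

Lemma levalE (P : {poly R}) :
  leval P = \sum_(i < size P) lconst P`_i * lT R ^+ i.
Proof.
rewrite /leval (horner_coef_wide _ (size_poly _ _)).
by apply: eq_bigr => i _; rewrite coef_map.
Qed.

Lemma tofrac_sum (P : {poly R}) :
  P%:F = \sum_(i < size P) lconst P`_i * lX R ^+ i.
Proof.
rewrite -{1}[P]coefK poly_def rmorph_sum; apply: eq_bigr => i _.
by rewrite -mul_polyC rmorphM rmorphXn.
Qed.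

Lemma fnorm_leval_le r P : 1 <= r -> fnorm v r (leval P) <= gauss v r P.
Proof.
move=> r1; have r0 : 0 < r by apply: lt_le_trans r1.
rewrite levalE; apply: fnorm_sum => // [|i]; first exact: gauss_ge0.
rewrite fnormM// fnormX// fnorm_lconst//; apply: le_trans (gauss_ge _ _ _ i).
by rewrite ler_wpM2l ?absv_ge0// lerXn2r ?nnegrE ?fnorm_ge0 ?fnorm_lT// ltW.
Qed.

(** For r > 1 the term X dominates X + 1/X, and P(X + 1/X) differs from P(X)
    by something strictly smaller.  For r = 1 only the inequality holds. *)
Lemma fnorm_leval r P : 1 < r -> fnorm v r (leval P) = gauss v r P.
Proof.
move=> r1; have r0 : 0 < r by apply: lt_trans r1.
have [->|P0] := eqVneq P 0; first by rewrite rmorph0 fnorm0// gauss0.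
rewrite -[leval P](subrK P%:F) addrC fnorm_dom// fnorm_tofrac//.
have gP := gauss_gt0 v r0 P0.
apply: (@le_lt_trans _ _ (gauss v r P * r^-1)); last first.
  by rewrite gtr_pMr// invf_lt1.
have C0 : 0 <= gauss v r P * r^-1 by rewrite mulr_ge0 ?invr_ge0 ?ltW.
rewrite levalE tofrac_sum -sumrB; apply: fnorm_sum => // i.
rewrite -mulrBr fnormM// fnorm_lconst//.
have rn n : 0 <= r ^+ n by rewrite exprn_ge0// ltW.
apply: (@le_trans _ _ (v P`_i * (r ^+ i * r^-1))); last first.
  by rewrite mulrA ler_wpM2r ?invr_ge0 ?(ltW r0)// gauss_ge.
rewrite ler_wpM2l ?absv_ge0// subrXX fnormM//.
have -> : lT R - lX R = (lX R)^-1 by rewrite /lT addrC addKr.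
rewrite fnormV ?lX_neq0// fnorm_lX// mulrC ler_wpM2r ?invr_ge0 ?(ltW r0)//.
apply: fnorm_sum => // j; rewrite fnormM// !fnormX// fnorm_lX//.
apply: (@le_trans _ _ (r ^+ (i.-1 - j) * r ^+ j)).
  by rewrite ler_wpM2r// lerXn2r ?nnegrE ?fnorm_ge0 ?(ltW r0) ?fnorm_lT ?(ltW r1).
rewrite -exprD; case: (nat_of_ord i) j => [|k] j; first by case: j.
rewrite subnK; last by rewrite -ltnS.
by rewrite ler_weXn2l// ltW.
Qed.

Notation Q := (quad ('X : {poly R})).

Definition qnorm r (a : Q) : K := fnorm v r (lquad a).

Lemma qnorm_ge0 r a : 0 <= qnorm r a.
Proof. exact: fnorm_ge0. Qed.

Lemma qnormM r a b : 0 < r -> qnorm r (a * b) = qnorm r a * qnorm r b.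
Proof. by move=> r0; rewrite /qnorm rmorphM fnormM. Qed.

Lemma qnormD r a b : 0 < r -> qnorm r (a + b) <= Num.max (qnorm r a) (qnorm r b).
Proof. by move=> r0; rewrite /qnorm rmorphD fnormD. Qed.

Lemma qnormN r a : 0 < r -> qnorm r (- a) = qnorm r a.
Proof. by move=> r0; rewrite /qnorm rmorphN fnormN. Qed.

Lemma qnorm_u r : 0 < r -> qnorm r (qgen _) = r.
Proof. by move=> r0; rewrite /qnorm lquad_u fnorm_lX. Qed.

Lemma qnorm_const r P : 1 < r -> qnorm r (qconst _ P) = gauss v r P.
Proof. by move=> r1; rewrite /qnorm /lquad /= rmorph0 mul0r addr0 fnorm_leval. Qed.

Lemma qnorm_le r (a : Q) : 1 <= r ->
  qnorm r a <= Num.max (gauss v r (qre a)) (gauss v r (qim a) * r).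
Proof.
move=> r1; have r0 : 0 < r by apply: lt_le_trans r1.
apply: le_trans (fnormD _ r0 _ _) _; rewrite ge_max !le_max fnorm_leval_le//=.
by rewrite fnormM// fnorm_lX// [X in _ || X]ler_wpM2r ?orbT ?fnorm_leval_le// ltW.
Qed.

(** A power of u clears the denominators, and its norm r^D turns the two
    sides of the inequality into each other, so that polynomials suffice. *)
Lemma qnorm_convex r a : 0 < r ->
  qnorm r a ^+ 2 <= qnorm 1 a * qnorm (r ^+ 2) a.
Proof.
move=> r0; have [D [G aG]] := lquad_laurent a.
have E s : 0 < s -> qnorm s a * s ^+ D = gauss v s G.
  by move=> s0; rewrite -(fnorm_tofrac v s0) -aG fnormM// fnormX// fnorm_lX.
have r20 : 0 < r ^+ 2 by rewrite exprn_gt0.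
have := gauss_convex v r G; rewrite -!E// exprMn expr1n mulr1 mulrA.
by rewrite -!exprM mulnC ler_pM2r// exprn_gt0.
Qed.

End LaurentNorm.

(** * Circle norms for entire coefficients *)

Definition ecoef (K : realType) (R : idomainType) (v : nonarch_absval K R)
  (f : entire v) : nat -> R := entire_series f.
Coercion ecoef : entire >-> Funclass.

Section EntireNorm.
Local Open Scope classical_set_scope.
Variables (K : realType) (R : idomainType) (v : nonarch_absval K R).
Notation A := (entire v).
Notation t := (entire_X v).
Notation B := (quad t).
Notation Q := (quad ('X : {poly R})).
Implicit Types (r : K) (f g : A) (a b : B).

Lemma entire_coefM f g i : ecoef (f * g : A) i = \sum_(j < i.+1) f j * g (i - j)%N.
Proof. by []. Qed.
Lemma entire_coefX i : t i = (i == 1)%:R. Proof. by []. Qed.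

Lemma entireP f g : (forall i, f i = g i) -> f = g.
Proof. by move=> fg; apply/val_inj/funext. Qed.

Fact poly_entire_subproof (P : {poly R}) :
  (fun i => P`_i : R) \in @entire_pred K R v.
Proof.
apply/mem_set/is_entireP => r r0; exists (gauss v r P) => i; exact: gauss_ge.
Qed.
Definition entire_poly (P : {poly R}) : A := Entire (poly_entire_subproof P).
Fact entire_poly_zmod : zmod_morphism entire_poly.
Proof. by move=> P P'; apply: entireP => i; rewrite /= coefB. Qed.
Fact entire_poly_monoid : monoid_morphism entire_poly.
Proof.
split=> [|P P']; apply: entireP => i; first by rewrite /= coef1.
by rewrite /= coefM.
Qed.
HB.instance Definition _ :=
  GRing.isZmodMorphism.Build {poly R} A entire_poly entire_poly_zmod.
HB.instance Definition _ :=
  GRing.isMonoidMorphism.Build {poly R} A entire_poly entire_poly_monoid.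

Lemma entire_polyX : entire_poly 'X = t.
Proof. by apply: entireP => i; rewrite /= coefX. Qed.

Definition entire_quad (a : Q) : B := Quad t (entire_poly (qre a)) (entire_poly (qim a)).
Fact entire_quad_zmod : zmod_morphism entire_quad.
Proof. by move=> [? ?] [? ?]; congr Quad; rewrite /= rmorphB. Qed.
Fact entire_quad_monoid : monoid_morphism entire_quad.
Proof.
split=> [|[? ?] [? ?]]; congr Quad; rewrite /= ?rmorph1 ?rmorph0//.
  by rewrite rmorphB !rmorphM.
by rewrite !rmorphD !rmorphM /= entire_polyX.
Qed.
HB.instance Definition _ :=
  GRing.isZmodMorphism.Build Q B entire_quad entire_quad_zmod.
HB.instance Definition _ :=
  GRing.isMonoidMorphism.Build Q B entire_quad entire_quad_monoid.

Lemma entire_quad_u : entire_quad (qgen _) = qgen t.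
Proof. by congr Quad; rewrite /= ?rmorph0 ?rmorph1. Qed.

Lemma entire_quad_conj (a : Q) : entire_quad (qconj a) = qconj (entire_quad a).
Proof. by congr Quad; rewrite /= ?rmorphN// rmorphD rmorphM /= entire_polyX. Qed.

Lemma entire_poly_inj : injective entire_poly.
Proof. by move=> P P' PP'; apply/polyP => i; have /(congr1 (fun f : A => f i)) := PP'. Qed.

Lemma entire_quad_inj : injective entire_quad.
Proof.
move=> [a b] [c d] E; congr Quad; apply: entire_poly_inj.
  exact: (congr1 (@qre _ _) E).
exact: (congr1 (@qim _ _) E).
Qed.

(** At least two coefficients are kept, so that t is always its own
    truncation. *)
Definition trunc (N : nat) f : {poly R} := \poly_(i < N.+2) f i.

Lemma coef_trunc N f i : (trunc N f)`_i = if (i < N.+2)%N then f i else 0.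
Proof. exact: coef_poly. Qed.

Lemma truncD N f g : trunc N (f + g) = trunc N f + trunc N g.
Proof.
by apply/polyP => i; rewrite coefD !coef_trunc; case: ifP; rewrite ?addr0.
Qed.

Lemma truncB N f g : trunc N (f - g) = trunc N f - trunc N g.
Proof.
by apply/polyP => i; rewrite coefB !coef_trunc; case: ifP; rewrite ?subr0.
Qed.

Lemma trunc_X N : trunc N t = 'X.
Proof.
apply/polyP => i; rewrite coef_trunc entire_coefX coefX.
by case: i => [|[|i]] //=; case: ifP.
Qed.

Lemma trunc_poly N (P : {poly R}) : (size P <= N.+2)%N -> trunc N (entire_poly P) = P.
Proof.
move=> PN; apply/polyP => i; rewrite coef_trunc /=; case: ltnP => // Ni.
by rewrite nth_default// (leq_trans PN).
Qed.

Definition qtrunc N a : Q := Quad 'X (trunc N (qre a)) (trunc N (qim a)).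

Section Radius.
Variables (r : K) (r1 : 1 <= r).
Let r0 : 0 < r. Proof. exact: lt_le_trans r1. Qed.

(** Geometric decay is all that is needed of error terms, and it is stable
    under the operations below. *)
Definition gsmall (P : nat -> {poly R}) :=
  exists C, forall N, gauss v r (P N) <= C * 2^-1 ^+ N.

Lemma gsmallD P P' : gsmall P -> gsmall P' -> gsmall (fun N => P N + P' N).
Proof.
move=> [C PC] [C' PC']; exists (Num.max C C') => N.
apply: le_trans (gaussD _ r0 _ _) _.
by rewrite maxr_pMl ?exprn_ge0 ?invr_ge0// ge_max !le_max PC PC' orbT.
Qed.

Lemma gsmallN P : gsmall P -> gsmall (fun N => - P N).
Proof. by move=> [C PC]; exists C => N; rewrite gaussN. Qed.

Lemma gsmallMX P : gsmall P -> gsmall (fun N => 'X * P N).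
Proof.
move=> [C PC]; exists (r * C) => N.
by rewrite gaussM// gaussX// -mulrA ler_wpM2l// ltW.
Qed.

(** Boundedness at radius 2 r gives geometric decay at radius r. *)
Lemma entire_decay f : exists2 C, 0 <= C & forall i, v (f i) * r ^+ i <= C * 2^-1 ^+ i.
Proof.
have /set_mem/is_entireP fE := entire_seriesP f.
have [C CP] := fE (2 * r) (mulr_gt0 (ltr0Sn K 1) r0).
exists C => [|i]; first by apply: le_trans (CP 0%N); rewrite mulr1 absv_ge0.
rewrite exprVn ler_pdivlMr ?exprn_gt0// -mulrA -exprMn (mulrC r).
exact: CP.
Qed.

Lemma half_le M N : (M <= N)%N -> (2^-1 : K) ^+ N <= 2^-1 ^+ M.
Proof. by move=> MN; rewrite ler_wiXn2l ?invr_ge0// invf_le1// ler1n. Qed.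

Lemma half_ge0 N : 0 <= (2^-1 : K) ^+ N.
Proof. by rewrite exprn_ge0// invr_ge0. Qed.

Lemma trunc_cauchy f : exists C, forall M N, (N <= M)%N ->
  gauss v r (trunc M f - trunc N f) <= C * 2^-1 ^+ N.
Proof.
have [C C0 fC] := entire_decay f; exists C => M N NM.
have CN m : 0 <= C * 2^-1 ^+ m by rewrite mulr_ge0 ?half_ge0.
apply: gauss_le => // i; rewrite coefB !coef_trunc.
case: (ltnP i N.+2) => [iN|Ni].
  by rewrite (leq_trans iN) ?ltnS// subrr absv0 mul0r.
rewrite subr0; case: ifP => _; last by rewrite absv0 mul0r.
apply: le_trans (fC i) _; rewrite ler_wpM2l// half_le//.
by apply: leq_trans Ni; rewrite -addn2 leq_addr.
Qed.

(** Truncation is multiplicative up to products of two coefficients whose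
    indices add up to a large number. *)
Lemma truncM_small f g : gsmall (fun N => trunc N (f * g) - trunc N f * trunc N g).
Proof.
have [C C0 fC] := entire_decay f; have [D D0 gD] := entire_decay g.
exists (C * D) => N; have CD m : 0 <= C * D * 2^-1 ^+ m by rewrite !mulr_ge0 ?half_ge0.
apply: gauss_le => // k; rewrite coefB coefM coef_trunc.
case: (ltnP k N.+2) => [kN|Nk].
  rewrite entire_coefM [X in _ - X](_ : _ = \sum_(j < k.+1) f j * g (k - j)%N).
    by rewrite subrr absv0 mul0r.
  apply: eq_bigr => j _; rewrite !coef_trunc.
  by rewrite !ifT// (leq_ltn_trans _ kN)// ?leq_subr// -ltnS.
rewrite sub0r absvN.
apply: (big_ind (fun x => v x * r ^+ k <= C * D * 2^-1 ^+ N)).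
- by rewrite absv0 mul0r.
- move=> x y xC yC; have rk : 0 <= r ^+ k by rewrite exprn_ge0// ltW.
  apply: le_trans (ler_wpM2r rk (absv_ultra _ _ _)) _.
  by rewrite maxr_pMl// ge_max xC yC.
- move=> j _; have jk : (j <= k)%N by rewrite -ltnS.
  apply: (@le_trans _ _ (C * D * 2^-1 ^+ k)); last first.
    rewrite ler_wpM2l ?mulr_ge0// half_le//.
    by apply: leq_trans Nk; rewrite -addn2 leq_addr.
  have E (x : K) : x ^+ k = x ^+ j * x ^+ (k - j) by rewrite -exprD subnKC.
  have tr (h : A) E' m : 0 <= E' -> (forall i, v (h i) * r ^+ i <= E' * 2^-1 ^+ i) ->
      v (trunc N h)`_m * r ^+ m <= E' * 2^-1 ^+ m.
    move=> E'0 hE; rewrite coef_trunc; case: ifP => // _.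
    by rewrite absv0 mul0r mulr_ge0 ?half_ge0.
  rewrite !E absvM mulrACA [X in _ <= X]mulrACA ler_pM ?tr//.
    by rewrite mulr_ge0 ?absv_ge0// exprn_ge0// ltW.
  by rewrite mulr_ge0 ?absv_ge0// exprn_ge0// ltW.
Qed.

Definition qsmall (d : nat -> Q) :=
  exists C, forall N, qnorm v r (d N) <= C * 2^-1 ^+ N.

Lemma qsmall_gsmall (d : nat -> Q) :
  gsmall (fun N => qre (d N)) -> gsmall (fun N => qim (d N)) -> qsmall d.
Proof.
move=> [C dC] [D dD]; exists (Num.max C (D * r)) => N.
apply: le_trans (qnorm_le _ _ r1) _.
rewrite maxr_pMl ?half_ge0// ge_max !le_max dC/=.
by rewrite mulrAC [X in _ || X]ler_wpM2r ?orbT// ltW.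
Qed.

Lemma qtruncM_small a b : qsmall (fun N => qtrunc N (a * b) - qtrunc N a * qtrunc N b).
Proof.
case: a b => [x y] [z w]; apply: qsmall_gsmall => /=.
  apply: (@eq_ind _ _ gsmall (gsmallD (truncM_small x z) (gsmallN (truncM_small y w)))).
  by apply/funext => N; rewrite truncB; ring.
apply: (@eq_ind _ _ gsmall (gsmallD
  (gsmallD (truncM_small x w) (truncM_small y z))
  (gsmallD (truncM_small t (y * w)) (gsmallMX (truncM_small y w))))).
apply/funext => N; rewrite !truncD trunc_X.
move: (trunc N (x * w)) (trunc N (y * z)) (trunc N (t * (y * w))) (trunc N (y * w)).
by move: (trunc N x) (trunc N y) (trunc N z) (trunc N w) => *; ring.
Qed.

Lemma qtrunc_cauchy a : exists C, forall M N, (N <= M)%N ->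
  qnorm v r (qtrunc M a - qtrunc N a) <= C * 2^-1 ^+ N.
Proof.
case: a => x y; have [C xC] := trunc_cauchy x; have [D yD] := trunc_cauchy y.
exists (Num.max C (D * r)) => M N NM; apply: le_trans (qnorm_le _ _ r1) _ => /=.
rewrite maxr_pMl ?half_ge0// ge_max !le_max xC//=.
by rewrite mulrAC [X in _ || X]ler_wpM2r ?orbT// ?yD// ltW.
Qed.

Lemma qnorm_dist (x y : Q) : `|qnorm v r x - qnorm v r y| <= qnorm v r (x - y).
Proof.
have H (z w : Q) : qnorm v r z - qnorm v r w <= qnorm v r (z - w).
  rewrite lerBlDr -{1}[z](subrK w); apply: le_trans (qnormD _ _ _ r0) _.
  by rewrite ge_max lerDl lerDr !qnorm_ge0.
by rewrite ler_norml lerNl opprB H -[x - y]opprB qnormN// H.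
Qed.

Lemma cvg_half C : C * (2^-1 : K) ^+ N @[N --> \oo] --> (0 : K).
Proof.
rewrite -[X in _ --> X](mulr0 C); apply: cvgM; first exact: cvg_cst.
by apply: cvg_expr; rewrite ger0_norm ?invr_ge0// invf_lt1// ltr1n.
Qed.

(** The Laurent expansion in u of an element with entire coefficients
    involves infinite sums, which need not exist in R; the norm of the expansion
    is reached as the limit of the norms of the truncations. *)
Definition unorm a : K := limn (fun N => qnorm v r (qtrunc N a)).

Lemma unorm_cvg a : qnorm v r (qtrunc N a) @[N --> \oo] --> unorm a.
Proof.
suff: cvgn (fun N => qnorm v r (qtrunc N a)) by [].
apply: cauchy_cvg; apply: cauchy_exP => e e0.
have [C aC] := qtrunc_cauchy a.
have /cvgrPdist_lt/(_ _ e0)[N _ NP] := cvg_half C.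
exists (qnorm v r (qtrunc N a)); exists N => // M /= NM.
rewrite /ball /= distrC; apply: le_lt_trans (qnorm_dist _ _) _.
apply: le_lt_trans (aC _ _ NM) _; apply: le_lt_trans (ler_norm _) _.
by have := NP N (leqnn N); rewrite /= sub0r normrN.
Qed.

Lemma unorm_approx a (u : nat -> K) l C : u @ \oo --> l ->
  (forall N, `|qnorm v r (qtrunc N a) - u N| <= C * 2^-1 ^+ N) -> unorm a = l.
Proof.
move=> ul uC; apply: (@cvg_unique _ (@Rhausdorff K)
  (fmap (fun N => qnorm v r (qtrunc N a)) \oo)) => //; first exact: unorm_cvg.
have d0 : (qnorm v r (qtrunc N a) - u N) @[N --> \oo] --> (0 : K).
  apply/norm_cvg0P; apply: (@squeeze_cvgr _ _ _ _ (cst 0) (fun N => C * 2^-1 ^+ N)).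
  - by near=> N; rewrite normr_ge0 uC.
  - exact: cvg_cst.
  - exact: cvg_half.
have -> : (fun N => qnorm v r (qtrunc N a)) =
    (fun N => qnorm v r (qtrunc N a) - u N) \+ u.
  by apply/funext => N; rewrite /= subrK.
by rewrite -[l]add0r; exact: cvgD.
Unshelve. all: by end_near. Qed.

Lemma unorm_ge0 a : 0 <= unorm a.
Proof.
apply: limr_ge; first exact: (cvgP _ (@unorm_cvg a)).
by near=> N; exact: qnorm_ge0.
Unshelve. all: by end_near. Qed.

Lemma unormM a b : unorm (a * b) = unorm a * unorm b.
Proof.
have [C abC] := qtruncM_small a b.
apply: (@unorm_approx _ _ _ C (cvgM (@unorm_cvg a) (@unorm_cvg b))) => N.
by rewrite /= -(qnormM v _ _ r0); apply: le_trans (qnorm_dist _ _) _; exact: abC.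
Qed.

Lemma unormD a b : unorm (a + b) <= Num.max (unorm a) (unorm b).
Proof.
apply: (@ler_cvg_to _ \oo _ _ (fun N => qnorm v r (qtrunc N (a + b)))
  (fun N => Num.max (qnorm v r (qtrunc N a)) (qnorm v r (qtrunc N b)))).
- exact: unorm_cvg.
- rewrite maxr_absE [X in fmap X _](_ : _ = (fun N => (qnorm v r (qtrunc N a) +
    qnorm v r (qtrunc N b) + `|qnorm v r (qtrunc N a) - qnorm v r (qtrunc N b)|) / 2)).
    apply: cvgM; last exact: cvg_cst.
    apply: cvgD; first by apply: cvgD; exact: unorm_cvg.
    by apply: cvg_norm; apply: cvgB; exact: unorm_cvg.
  by apply/funext => N; rewrite maxr_absE.
- near=> N; apply: le_trans (qnormD _ _ _ r0); rewrite le_eqVlt; apply/orP; left.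
  by apply/eqP; congr qnorm; congr Quad; rewrite /= truncD.
Unshelve. all: by end_near. Qed.

Lemma unorm_quad (a : Q) : unorm (entire_quad a) = qnorm v r a.
Proof.
apply: (@cvg_unique _ (@Rhausdorff K)
  (fmap (fun N => qnorm v r (qtrunc N (entire_quad a))) \oo)) => //.
  exact: unorm_cvg.
apply: (cvg_trans _ (@cvg_cst _ (qnorm v r a) _ \oo _)).
apply: near_eq_cvg; exists (maxn (size (qre a)) (size (qim a))) => // N /= aN.
rewrite /cst /qtrunc /= !trunc_poly; last 2 first.
- by rewrite (leq_trans _ (leq_trans aN _)) ?leq_maxr// -addn2 leq_addr.
- by rewrite (leq_trans _ (leq_trans aN _)) ?leq_maxl// -addn2 leq_addr.
by case: (a).
Qed.

Lemma unorm1 : unorm 1 = 1.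
Proof. by rewrite -(rmorph1 entire_quad) unorm_quad /qnorm rmorph1 fnorm1. Qed.

Lemma unorm_u : unorm (qgen t) = r.
Proof. by rewrite -entire_quad_u unorm_quad qnorm_u. Qed.

End Radius.

(** The norm is at least the Gauss norm on entire functions, so that it
    controls every coefficient. *)
Lemma unorm_coef r f i : 1 < r -> v (f i) * r ^+ i <= unorm r (qconst t f).
Proof.
move=> r1; rewrite /unorm; apply: limr_ge.
  by apply: (cvgP (unorm r (qconst t f))); exact: (unorm_cvg (ltW r1)).
near=> N; have -> : qtrunc N (qconst t f) = qconst _ (trunc N f).
  by congr Quad; apply/polyP => k; rewrite /= coef_trunc coef0; case: ifP.
rewrite qnorm_const//; apply: le_trans (gauss_ge _ _ _ i).
rewrite coef_trunc ifT//; near: N; exists i => // N /= iN.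
by rewrite (leq_ltn_trans iN)// -addn2 leq_addr.
Unshelve. all: by end_near. Qed.

Lemma unorm_convex r a : 1 <= r -> unorm r a ^+ 2 <= unorm 1 a * unorm (r ^+ 2) a.
Proof.
move=> r1; have r21 : 1 <= r ^+ 2 by rewrite exprn_ege1.
apply: (@ler_cvg_to _ \oo _ _ (fun N => qnorm v r (qtrunc N a) ^+ 2)
  (fun N => qnorm v 1 (qtrunc N a) * qnorm v (r ^+ 2) (qtrunc N a))).
- by rewrite expr2; apply: cvgM; exact: unorm_cvg.
- by apply: cvgM; exact: unorm_cvg.
- by near=> N; apply: qnorm_convex; apply: lt_le_trans r1.
Unshelve. all: by end_near. Qed.

End EntireNorm.

(** * The Pell equation *)

Section PolyPell.
Variable R : idomainType.
Notation Q := (quad ('X : {poly R})).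

(** Descent: comparing the leading terms in x^2 + t x y + y^2 = 1 shows that
    x and y have different degrees unless one of them is 0, and multiplying by u
    or by 1/u lowers the larger one. *)
Lemma pell_poly (a : Q) : a * qconj a = 1 ->
  exists n, a = qpow 'X n \/ a = - qpow 'X n.
Proof.
have [m] := ubnP (size (qre a) + size (qim a)).
elim: m a => // m IH a am aa.
have : qre a * qre a + 'X * (qre a * qim a) + qim a * qim a = 1.
  by have /(congr1 (@qre _ _)) := aa; case: (a) => x y /= <-; ring.
case: a am aa => x y /= am aa xy.
have sqr1 (z : {poly R}) : z * z = 1 -> z = 1 \/ z = -1.
  move=> /eqP zz; have : (z - 1) * (z + 1) == 0.
    by rewrite -subr_sqr expr1n expr2 subr_eq0.
  by rewrite mulf_eq0 subr_eq0 addr_eq0 => /orP[]/eqP ->; [left|right].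
have [y0|y0] := eqVneq y 0.
  move: xy; rewrite y0 !mulr0 !addr0 => /sqr1 [->|->]; exists 0; [by left|right].
  by rewrite qpow0; congr Quad; rewrite /= oppr0.
have [x0|x0] := eqVneq x 0.
  move: xy; rewrite x0 !(mul0r, mulr0) !add0r => /sqr1 [->|->]; exists 1; [by left|right].
  by rewrite qpow1; congr Quad; rewrite /= oppr0.
have step (d : int) : (size (qre (Quad 'X x y * qpow 'X d)%R) +
    size (qim (Quad 'X x y * qpow 'X d)%R) < size x + size y)%N ->
    exists n, Quad 'X x y = qpow 'X n \/ Quad 'X x y = - qpow 'X n.
  move=> lt; have [||n nP] := IH (Quad 'X x y * qpow 'X d).
  - exact: leq_trans lt _.
  - by rewrite qconjM mulrACA aa mul1r qpow_conj qpowN.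
  exists (n - d); rewrite qpowD -mulNr.
  by case: nP => <-; [left|right]; rewrite ?opprK -mulrA qpowN mulr1.
have sqr_size (z w : {poly R}) : z != 0 -> (0 < size w)%N ->
    z * (z + 'X * w) = 1 - w * w -> (size w < size z)%N ->
    (size (z + 'X * w)%R < size z)%N.
  move=> z0 w0 zw wz; have [->|zw0] := eqVneq (z + 'X * w) 0.
    by rewrite size_poly0 lt0n size_poly_eq0.
  have := congr1 (fun P : {poly R} => size P) zw; rewrite size_mul// => E.
  have : (size (1 - w * w)%R <= (size w + size w).-1)%N.
    apply: leq_trans (size_polyD _ _) _; rewrite size_polyN geq_max.
    by rewrite size_polyC oner_eq0 size_mul -?size_poly_gt0// leqnn andbT; lia.
  by rewrite -E; lia.
have sx : (0 < size x)%N by rewrite size_poly_gt0.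
have sy : (0 < size y)%N by rewrite size_poly_gt0.
case: (ltngtP (size x) (size y)) => lxy.
- apply: (step (-1)); rewrite -qpow_conj qpow1 mul_conj_qgen /= size_polyN.
  rewrite addnC ltn_add2l; apply: sqr_size => //.
  by rewrite -xy; ring.
- apply: (step 1); rewrite qpow1 mul_qgen /= size_polyN.
  rewrite addnC ltn_add2r; apply: sqr_size => //.
  by rewrite -xy; ring.
exfalso; have := congr1 (fun P : {poly R} => size P) xy.
have xy0 : x * y != 0 by rewrite mulf_neq0.
have sxy : size ('X * (x * y))%R = (size x + size y)%N.
  by rewrite mulrC size_mulX// size_mul// prednK// addn_gt0 sx.
rewrite addrAC addrC size_polyDl sxy ?size_poly1; first by lia.
apply: leq_ltn_trans (size_polyD _ _) _; rewrite gtn_max !size_mul//.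
by rewrite -lxy andbb ltn_predL addn_gt0 sx.
Qed.

End PolyPell.

Section Growth.
Variables (K : realType) (R : idomainType) (v : nonarch_absval K R).
Notation A := (entire v).
Notation t := (entire_X v).
Notation B := (quad t).
Notation Q := (quad ('X : {poly R})).
Implicit Types (r : K) (f g : A) (a b : B).
Local Notation qu := (qgen t).
Local Notation upow := (qpow t).

Lemma unormN r a : 1 <= r -> unorm r (- a) = unorm r a.
Proof.
move=> r1; have r0 : 0 < r by apply: lt_le_trans r1.
rewrite -mulN1r unormM// -(rmorphN1 (@entire_quad K R v)) unorm_quad//.
by rewrite qnormN// /qnorm rmorph1 fnorm1// mul1r.
Qed.

Lemma unormB r a b : 1 <= r -> unorm r (a - b) <= Num.max (unorm r a) (unorm r b).
Proof. by move=> r1; rewrite -(unormN b r1); exact: unormD. Qed.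

Lemma unorm_dom r a b : 1 <= r -> unorm r b < unorm r a -> unorm r (a + b) = unorm r a.
Proof.
move=> r1 ba; apply/eqP; rewrite eq_le; apply/andP; split.
  by apply: le_trans (unormD r1 _ _) _; rewrite ge_max lexx ltW.
rewrite leNgt; apply/negP => lt.
have := unormB (a + b) b r1.
by rewrite addrK leNgt gt_max lt ba.
Qed.

Lemma unorm_exp r a n : 1 <= r -> unorm r (a ^+ n) = unorm r a ^+ n.
Proof. by move=> r1; elim: n => [|n IH]; rewrite ?unorm1// !exprS unormM// IH. Qed.

Lemma unorm_conj_u r : 1 <= r -> unorm r (qconj qu) = r^-1.
Proof.
move=> r1; have r0 : r != 0 by rewrite gt_eqF// (lt_le_trans _ r1).
apply: (mulfI r0); rewrite divff// -{1}(unorm_u v r1) -unormM//.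
by rewrite qgen_conj unorm1.
Qed.

Lemma unorm_upow r n : 1 <= r -> unorm r (upow n) = r ^ n.
Proof.
move=> r1; case: n => n; first by rewrite /= unorm_exp// unorm_u.
by rewrite /= unorm_exp// unorm_conj_u// NegzE /= exprVn.
Qed.

Lemma unorm_subu r : 1 < r -> unorm r (qu - qconj qu) = r.
Proof.
move=> r1; have r1' := ltW r1; rewrite unorm_dom ?unorm_u//.
rewrite unormN// unorm_conj_u//; apply: (lt_trans _ r1).
by rewrite invf_lt1// (lt_trans _ r1).
Qed.

Lemma unorm_im r a : 1 < r ->
  unorm r (qconst t (qim a)) * r <= Num.max (unorm r a) (unorm r (qconj a)).
Proof.
move=> r1; have r1' := ltW r1.
by rewrite -{2}(unorm_subu r1) -unormM// -sub_qconj unormB.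
Qed.

Lemma unorm_re r a : 1 < r ->
  unorm r (qconst t (qre a)) <= Num.max (unorm r a) (unorm r (qconj a)).
Proof.
move=> r1; have r1' := ltW r1.
have -> : qconst t (qre a) = a - qconst t (qim a) * qu by rewrite {2}[a]quadE addrK.
apply: le_trans (unormB _ _ r1') _.
by rewrite unormM// unorm_u// ge_max unorm_im// le_max lexx.
Qed.

(** Such an element would be a Laurent series in u that tends to 0 at
    infinity and stays bounded at 0: the coefficient of u must vanish, so that
    the element is its own conjugate, and then the two bounds contradict each
    other. *)
Lemma no_decay a :
  (forall r, 1 < r -> unorm r a <= r^-1) -> (forall r, 1 < r -> unorm r (qconj a) = 1) ->
  False.
Proof.
move=> aP caP.
have y0 : qim a = 0.
  apply: entireP => i; rewrite -/(ecoef 0 i); apply/eqP/negPn/negP => yi.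
  have vy : 0 < v (qim a i) by rewrite absv_gt0.
  (* At this radius v(y_i) r = v(y_i) + 1 exceeds the bound 1 obtained below. *)
  pose r := 1 + (v (qim a i))^-1.
  have r1 : 1 < r by rewrite ltrDl invr_gt0.
  have r0 : 0 < r := lt_trans ltr01 r1.
  have yr : v (qim a i) * r <= 1.
    apply: (@le_trans _ _ (unorm r (qconst t (qim a)) * r)).
      rewrite ler_wpM2r ?(ltW r0)//; apply: le_trans (unorm_coef _ i r1).
      by rewrite ler_peMr ?absv_ge0// exprn_ege1// ltW.
    apply: le_trans (unorm_im _ r1) _; rewrite caP// ge_max lexx andbT.
    by apply: le_trans (aP _ r1) _; rewrite invf_le1// ltW.
  by move: yr; rewrite mulrDr mulr1 divff ?gt_eqF// gerDr leNgt vy.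
have a_conj : qconj a = a.
  by rewrite [a]quadE y0 rmorph0 mul0r addr0 qconj_const.
have r1 : (1 : K) < 2 by rewrite ltr1n.
by have := aP _ r1; rewrite -[a]a_conj caP// leNgt invf_lt1// r1.
Qed.

(** Liouville's theorem along the radii 2^(2^k).  These radii are the
    ones that repeated squaring of 2 reaches in [pell_growth]. *)
Lemma entire_bounded_poly f C d :
  (forall k, unorm (2 ^+ (2 ^ k)%N) (qconst t f) <= C * (2 ^+ (2 ^ k)%N) ^+ d) ->
  exists P, f = entire_poly v P.
Proof.
move=> fC; exists (\poly_(i < d.+1) f i); apply: entireP => i.
rewrite /ecoef /= coef_poly; case: ltnP => // di.
apply/eqP/negPn/negP => fi; have vf : 0 < v (f i) by rewrite absv_gt0.
have [k kP] := ubnP (Num.truncn (C / v (f i))).+1.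
have r1 : (1 : K) < 2 ^+ (2 ^ k)%N by rewrite exprn_egt1 ?ltr1n// -lt0n expn_gt0.
have r0 := lt_trans ltr01 r1.
have := le_trans (unorm_coef f i r1) (fC k).
have -> : (2 ^+ (2 ^ k)%N : K) ^+ i = (2 ^+ (2 ^ k)%N) ^+ (i - d) * (2 ^+ (2 ^ k)%N) ^+ d.
  by rewrite -exprD subnK// ltnW.
rewrite mulrA ler_pM2r ?exprn_gt0// => fiC.
have : v (f i) * 2 ^+ (2 ^ k)%N <= C.
  apply: (le_trans _ fiC); apply: ler_wpM2l; first exact: ltW.
  by rewrite -{1}[2 ^+ _]expr1; apply: ler_weXn2l; rewrite ?subn_gt0// ltW.
rewrite -ler_pdivlMl// mulrC leNgt => /negP; apply.
apply: lt_trans (truncnS_gt _) _; rewrite -natrX ltr_nat.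
by apply: (ltn_trans _ (ltn_expl _ _)); rewrite // (leq_trans kP)// ltnW// ltn_expl.
Qed.

Lemma quad_bounded_poly a C d :
  (forall k, unorm (2 ^+ (2 ^ k)%N) a <= C * (2 ^+ (2 ^ k)%N) ^+ d) ->
  (forall k, unorm (2 ^+ (2 ^ k)%N) (qconj a) <= C * (2 ^+ (2 ^ k)%N) ^+ d) ->
  exists a' : Q, a = entire_quad v a'.
Proof.
move=> aC caC.
have r1 k : (1 : K) < 2 ^+ (2 ^ k)%N by rewrite exprn_egt1 ?ltr1n// -lt0n expn_gt0.
have [k|x xE] := @entire_bounded_poly (qre a) C d.
  by apply: le_trans (unorm_re a (r1 k)) _; rewrite ge_max aC caC.
have [k|y yE] := @entire_bounded_poly (qim a) C d.
  apply: (@le_trans _ _ (unorm (2 ^+ (2 ^ k)%N) (qconst t (qim a)) * 2 ^+ (2 ^ k)%N)).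
    by rewrite ler_peMr ?unorm_ge0// ltW.
  by apply: le_trans (unorm_im a (r1 k)) _; rewrite ge_max aC caC.
by exists (Quad _ x y); rewrite /entire_quad /= -xE -yE; case: (a).
Qed.

(** Log-convexity holds for a and for its inverse, so that both
    inequalities are equalities. *)
Lemma pell_loglinear r a : 1 <= r -> a * qconj a = 1 ->
  unorm r a ^+ 2 = unorm 1 a * unorm (r ^+ 2) a.
Proof.
move=> r1 aa; have r2 : 1 <= r ^+ 2 by rewrite exprn_ege1.
have E s : 1 <= s -> unorm s a * unorm s (qconj a) = 1 by move=> s1; rewrite -unormM// aa unorm1.
have P s : 1 <= s -> 0 < unorm s a.
  move=> s1; rewrite lt0r unorm_ge0// andbT; apply/eqP => s0.
  by have := E s s1; rewrite s0 mul0r => /eqP; rewrite eq_sym oner_eq0.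
apply/eqP; rewrite eq_le unorm_convex//=.
have := unorm_convex (qconj a) r1.
have V s : 1 <= s -> unorm s (qconj a) = (unorm s a)^-1.
  by move=> s1; apply: (mulfI (lt0r_neq0 (P s s1))); rewrite E// divff// gt_eqF// P.
rewrite !V// -invfM exprVn lef_pV2// ?posrE ?exprn_gt0 ?mulr_gt0 ?P//.
Qed.

Lemma pell_growth a : a * qconj a = 1 -> exists C d, 0 <= C /\
  forall k, unorm (2 ^+ (2 ^ k)%N) a <= C * (2 ^+ (2 ^ k)%N) ^+ d.
Proof.
move=> aa; have r1 : (1 : K) <= 2 by rewrite ler1n.
have c0 : 0 < unorm 1 a.
  rewrite lt0r unorm_ge0// andbT; apply/eqP => a0.
  have := unorm1 v (lexx 1); rewrite -aa unormM// a0 mul0r => /eqP.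
  by rewrite eq_sym oner_eq0.
(* The growth exponent: 2^d bounds the ratio of the norms at radii 2 and 1. *)
pose d := (Num.truncn (unorm 2 a / unorm 1 a)).+1.
exists (unorm 1 a), d; split=> [|k]; first exact: ltW.
have -> : unorm (2 ^+ (2 ^ k)%N) a = unorm 1 a * (unorm 2 a / unorm 1 a) ^+ (2 ^ k)%N.
  elim: k => [|k IH]; first by rewrite expn0 !expr1 mulrCA divff ?mulr1// gt_eqF.
  apply: (mulfI (lt0r_neq0 c0)); rewrite expnSr !exprM.
  rewrite -pell_loglinear ?exprn_ege1// IH.
  by move: ((unorm 2 a / unorm 1 a) ^+ _) => y; ring.
rewrite ler_pM2l// exprAC lerXn2r ?nnegrE ?divr_ge0 ?unorm_ge0 ?exprn_ge0//.
apply: le_trans (ltW (truncnS_gt _)) _.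
by rewrite -natrX ler_nat ltnW// ltn_expl.
Qed.

Lemma pell_quad_poly a : a * qconj a = 1 -> exists a' : Q, a = entire_quad v a'.
Proof.
move=> aa; have [C [d [C0 aC]]] := pell_growth aa.
have [|D [e [D0 caD]]] := @pell_growth (qconj a); first by rewrite qconjK mulrC.
have r1 k : (1 : K) <= 2 ^+ (2 ^ k)%N by rewrite exprn_ege1// ler1n.
apply: (@quad_bounded_poly a (C + D) (maxn d e)) => k.
  apply: le_trans (aC k) _; rewrite ler_pM ?exprn_ge0 ?lerDl//.
  by rewrite ler_weXn2l// leq_maxl.
apply: le_trans (caD k) _; rewrite ler_pM ?exprn_ge0 ?lerDr//.
by rewrite ler_weXn2l// leq_maxr.
Qed.

Lemma entire_quad_upow n : entire_quad v (qpow 'X n) = upow n.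
Proof.
case: n => n.
  transitivity (entire_quad v (qgen _) ^+ n); first exact: rmorphXn.
  by rewrite entire_quad_u.
transitivity (entire_quad v (qconj (qgen _)) ^+ n.+1).
  exact: rmorphXn.
by rewrite entire_quad_conj entire_quad_u.
Qed.

(** The rationality theorem: entire solutions of the Pell equation are
    polynomials, hence the obvious ones. *)
Theorem pell a : a * qconj a = 1 -> exists n, a = upow n \/ a = - upow n.
Proof.
move=> aa; have [a' a'E] := pell_quad_poly aa.
have [|n nP] := @pell_poly _ a'.
  apply: (@entire_quad_inj _ _ v).
  by rewrite rmorphM rmorph1 /= entire_quad_conj -a'E.
exists n; rewrite a'E -entire_quad_upow.
by case: nP => ->; [left|right]; rewrite // rmorphN.
Qed.

End Growth.

(** * Prime-to-p parts and perfect powers of polynomials *)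

(** With [b] telling whether p = 2, the polynomial x + 1 or x^2 + x + 1 is
    palindromic, takes a nonzero value at 1, and becomes separable after x is
    replaced by x^n with n prime to p.  The perfect powers considered have
    exponent 2 + b, which is a prime other than p. *)
Definition cycl (b : bool) (S : nzRingType) (x : S) : S :=
  if b then x ^+ 2 + x + 1 else x + 1.

Lemma rmorph_cycl b (S T : nzRingType) (f : {rmorphism S -> T}) x :
  f (cycl b x) = cycl b (f x).
Proof. by case: b; rewrite /cycl !rmorphD rmorph1 ?rmorphXn. Qed.

Lemma cycl_frobenius p b (S : comNzRingType) (x : S) s : p \in [pchar S] ->
  cycl b (x ^+ (p ^ s)) = cycl b x ^+ (p ^ s).
Proof.
move=> pS; have pn : ([pchar S]).-nat (p ^ s)%N.
  by rewrite pnatX pnatE ?(pcharf_prime pS)// pS.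
by case: b; rewrite /cycl !(exprDn_pchar _ _ pn) expr1n// exprAC.
Qed.

(** The polynomials are palindromic, so that negative exponents reduce to
    positive ones. *)
Lemma cyclV (F : fieldType) b (x : F) : x != 0 ->
  cycl b x^-1 * x ^+ (1 + b) = cycl b x.
Proof. by move=> x0; rewrite /cycl; case: b => /=; field. Qed.

Section Field.
Variable F : fieldType.
Implicit Types (a b Q : {poly F}).

Lemma separable_dvd_exp a b j : separable_poly a -> a %| b ^+ j -> a %| b.
Proof.
move=> sa ab; pose g := gcdp a b.
have /dvdpP[a' aE] : g %| a by apply: dvdp_gcdl.
have : separable_poly (a' * g) by rewrite -aE.
rewrite separable_mul => /and3P[_ _ co].
have co' : coprimep a' (b ^+ j).
  apply: coprimep_expr; apply/coprimepP => d da db.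
  move/coprimepP: co => /(_ d da); apply.
  by rewrite dvdp_gcd db andbT aE dvdp_mulr.
have a'b : a' %| b ^+ j by apply: dvdp_trans ab; rewrite aE dvdp_mulr.
have a'1 : a' %= 1 by move/coprimepP: co'; apply.
apply: dvdp_trans (dvdp_gcdr a b); rewrite -/g aE -[X in _ %| X]mul1r.
by rewrite dvdp_mul//; case/andP: a'1.
Qed.

Lemma coprimep_X a : a.[0] != 0 -> coprimep a 'X.
Proof. by move=> a0; rewrite -['X]subr0 -polyC0 coprimep_XsubC. Qed.

(** A root of a has multiplicity i in a^i; since k does not divide i, the root
    must also occur in the other factors, thus in b because it is not 0. *)
Lemma separable_dvd_power a b Q k i j e :
  (0 < k)%N -> separable_poly a -> a.[0] != 0 -> ~~ (k %| i)%N ->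
  a ^+ i * b ^+ j * 'X^e = Q ^+ k -> a %| b.
Proof.
move=> k0 sa a0 ki E.
have an0 : a != 0 by apply: contraNneq a0 => ->; rewrite horner0.
have i'0 : (0 < i %% k)%N by rewrite lt0n.
have i'k : (i %% k < k)%N by rewrite ltn_mod.
have /dvdpP[Q' QE] : a ^+ (i %/ k) %| Q.
  rewrite -(dvdp_pexp2r _ _ k0) -E -exprM [in X in _ %| X](divn_eq i k) exprD -!mulrA.
  exact: dvdp_mulr.
have E' : a ^+ (i %% k) * b ^+ j * 'X^e = Q' ^+ k.
  apply: (mulfI (expf_neq0 (i %/ k * k) an0)).
  rewrite !mulrA -exprD -divn_eq E QE exprMn -exprM mulrC; congr (_ * _).
have aQ' : a %| Q'.
  apply: (@separable_dvd_exp _ _ k) => //; rewrite -E' -(prednK i'0) exprS -!mulrA.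
  exact: dvdp_mulr.
have : a ^+ (k - i %% k) %| b ^+ j * 'X^e.
  rewrite -(dvdp_mul2l _ _ (expf_neq0 (i %% k) an0)) -exprD subnKC ?(ltnW i'k)//.
  by rewrite mulrA E' dvdp_exp2r.
rewrite -[(k - _)%N]prednK ?subn_gt0// exprS => /(dvdp_trans (dvdp_mulr _ (dvdpp a))).
rewrite Gauss_dvdpl; first exact: separable_dvd_exp.
by apply: coprimep_expr; apply: coprimep_X.
Qed.


Section Characteristic.
Variables (p : nat).
Hypothesis pF : p \in [pchar F].
Local Notation b2 := (p == 2)%N.

Let p_pr : prime p. Proof. exact: pcharf_prime pF. Qed.

Let pP : p \in [pchar {poly F}].
Proof. by rewrite inE p_pr -polyC_natr (pcharf0 pF) polyC0 eqxx. Qed.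

Lemma two_eq0 : ((2 : F) == 0) = b2.
Proof.
by rewrite -(dvdn_pcharf pF) dvdn_prime2.
Qed.

Lemma cycl_at0 n : (0 < n)%N -> (cycl b2 ('X^n : {poly F})).[0] != 0.
Proof.
by move=> n0; rewrite /cycl; case: ifP => _;
  rewrite !hornerE ?hornerXn expr0n eqn0Ngt n0 ?expr0n/= ?mul0r ?add0r oner_neq0.
Qed.

Lemma separable_cycl n : ~~ (p %| n)%N -> separable_poly (cycl b2 ('X^n : {poly F})).
Proof.
move=> pn; have n0 : (0 < n)%N by case: n pn; rewrite ?dvdn0.
have nF : n%:R != 0 :> F by rewrite -(dvdn_pcharf pF).
have dE : (cycl b2 ('X^n : {poly F}))^`() = n%:R *: 'X^(n.-1).
  rewrite /cycl; case: eqP => [p2|_].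
    rewrite !derivD derivC addr0 -exprM !derivXn -mulr_natl natrM.
    have -> : 2%:R = 0 :> {poly F} by rewrite -p2 (pcharf0 pP).
    rewrite mulr0 mul0r add0r.
    by rewrite -mulr_natl -polyC_natr mul_polyC.
  by rewrite derivD derivC addr0 derivXn -mulr_natl -polyC_natr mul_polyC.
rewrite unlock dE coprimepZr//.
by apply: coprimep_expr; apply: coprimep_X; exact: cycl_at0.
Qed.

Lemma size_cycl n : (0 < n)%N ->
  size (cycl b2 ('X^n : {poly F})) = (n * (b2).+1).+1.
Proof.
move=> n0; have s1 : size ('X^n + 1 : {poly F}) = n.+1 by rewrite size_XnaddC.
rewrite /cycl; case: eqP => [_|_] /=; last by rewrite muln1.
by rewrite -addrA size_polyDl -exprM size_polyXn// s1 ltnS; lia.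
Qed.

Lemma size_cycl0 : size (cycl b2 ('X^0 : {poly F})) = 1%N.
Proof.
rewrite expr0 /cycl; case: eqP => [p2|p2].
  rewrite expr1n -addrA (_ : 1 + 1 = 0) ?addr0 ?size_poly1//.
  by rewrite -(pcharf0 pP) p2.
by rewrite -[1]polyC1 -polyCD size_polyC two_eq0; move/eqP/negbTE: p2 => ->.
Qed.

(** With n' and m' the prime-to-p parts, the separable polynomial at x^n'
    divides a power of the one at x^m', hence that polynomial itself, and the
    degrees compare n' and m'. *)
Lemma cycl_power_dir n m i j e (Q : {poly F}) : (0 < n)%N -> ~~ ((2 + b2) %| i)%N ->
  cycl b2 'X^n ^+ i * cycl b2 'X^m ^+ j * 'X^e = Q ^+ (2 + b2) ->
  (0 < m)%N /\ (n`_p^' <= m`_p^')%N.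
Proof.
move=> n0 ki E.
have part k : cycl b2 ('X^k : {poly F}) = cycl b2 'X^(k`_p^') ^+ (p ^ logn p k) \/ k = 0%N.
  case: (posnP k) => [->|k0]; [by right|left].
  by rewrite -(cycl_frobenius _ _ _ pP) -exprM -p_part mulnC partnC.
have pn' : ~~ (p %| n`_p^')%N.
  rewrite -prime_coprime//; apply: (@pnat_coprime p); rewrite ?part_pnat//.
  by rewrite pnatE ?inE.
have n'0 : (0 < n`_p^')%N by rewrite part_gt0.
have dv : cycl b2 ('X^(n`_p^') : {poly F}) %| cycl b2 'X^m.
  apply: (@separable_dvd_power _ _ Q (2 + b2) (p ^ logn p n * i) j e) => //.
  - exact: separable_cycl.
  - exact: cycl_at0.
  - rewrite Gauss_dvdr// coprimeXr//.
    rewrite prime_coprime; last by case: (b2).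
    rewrite dvdn_prime2//; last by case: (b2).
    by case: (eqVneq p 2%N) => [->//|p2]; rewrite addn0 eq_sym.
  - by rewrite exprM; case: (part n) n0 => [<-|->].
have m0 : (0 < m)%N.
  rewrite lt0n; apply/eqP => m0; move: dv; rewrite m0 => /dvdp_leq.
  rewrite -size_poly_gt0 size_cycl0 size_cycl// => /(_ isT).
  by rewrite ltnS leqn0 muln_eq0 orbF eqn0Ngt n'0.
have m'0 : (0 < m`_p^')%N by rewrite part_gt0.
split=> //; case: (part m) dv => [->|m00]; last by rewrite m00 in m0.
move=> /(separable_dvd_exp (separable_cycl pn')) /dvdp_leq.
by rewrite -size_poly_gt0 !size_cycl// => /(_ isT); rewrite ltnS leq_pmul2r.
Qed.

End Characteristic.
End Field.

(** * Divisibility between powers of u *)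

Section Relations.
Variables (S : comNzRingType) (t : S).
Implicit Types (a b c : quad t).

Definition qdvd a b := exists c, b = a * c.

Lemma qdvd_mulr a b c : qdvd a b -> qdvd a (b * c).
Proof. by move=> [d ->]; exists (d * c); rewrite mulrA. Qed.
Lemma qdvd_add a b c : qdvd a b -> qdvd a c -> qdvd a (b + c).
Proof. by move=> [d ->] [e ->]; exists (d + e); rewrite mulrDr. Qed.
Lemma qdvd_opp a b : qdvd a b -> qdvd a (- b).
Proof. by move=> [d ->]; exists (- d); rewrite mulrN. Qed.
Lemma qdvd_sub a b c : qdvd a b -> qdvd a c -> qdvd a (b - c).
Proof. by move=> ab ac; apply: qdvd_add => //; apply: qdvd_opp. Qed.
Lemma qdvd_refl a : qdvd a a.
Proof. by exists 1; rewrite mulr1. Qed.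

(** The second condition selects u^n among u^n and - u^n. *)
Definition is_pow a := a * qconj a = 1 /\ qdvd (qgen t - 1) (a - 1).
Definition exp_dvd a b := qdvd (a - 1) (b - 1).
(** This holds when the exponent of b is p^s times that of a with s > 0, and
    excludes that the two exponents agree up to sign. *)
Definition exp_pdvd a b := qdvd ((a - 1) ^+ 2) (b - 1).
(** Perfect powers compare prime-to-p parts.  Cubes are used when p = 2; the
    multiplicities 1 and 2^s then add up to a multiple of 3 either as they are
    or after the first one is doubled. *)
Definition exp_sim a b :=
  ((exists c : S, c + c = 1) /\
    (exists z, cycl false a * cycl false b = z ^+ 2)) \/
  ((1 + 1 = 0 :> S) /\
    ((exists z, cycl true a * cycl true b = z ^+ 3) \/
     (exists z, cycl true a ^+ 2 * cycl true b = z ^+ 3))).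

Local Notation upow := (qpow t).

Lemma qpowN_sub1 n : upow (- n) - 1 = - upow (- n) * (upow n - 1).
Proof. by rewrite mulrBr mulNr [_ * upow n]mulrC qpowN mulr1 opprK addrC. Qed.

Lemma qdvd_upow_opp m k b :
  qdvd ((upow m - 1) ^+ k) b -> qdvd ((upow (- m) - 1) ^+ k) b.
Proof.
move=> [c ->]; exists (c * (- upow m) ^+ k); rewrite mulrCA -exprMn mulrC.
have -> : upow m - 1 = - upow m * (upow (- m) - 1).
  by have := qpowN_sub1 (- m); rewrite opprK.
by congr (_ * _ ^+ _); exact: mulrC.
Qed.

(** Replacing an exponent by its opposite multiplies u^m - 1 by a unit. *)
Lemma qdvd_upow_abs m k b :
  qdvd ((upow m - 1) ^+ k) b -> qdvd ((upow `|m|%N - 1) ^+ k) b.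
Proof.
have [{1}->|{1}->//] : m = - `|m|%N%:Z \/ m = `|m|%N%:Z by lia.
by move=> /qdvd_upow_opp; rewrite opprK.
Qed.

Lemma qdvd_upowM m k : qdvd (upow m - 1) (upow (m * k) - 1).
Proof.
case: k => k.
  by rewrite -qpowXn subrX1; exists (\sum_(i < k) upow m ^+ i).
rewrite NegzE mulrN -mulNr -qpowXn subrX1 qpowN_sub1.
by rewrite -!mulrA mulrCA; apply: qdvd_mulr; apply: qdvd_refl.
Qed.

End Relations.

Section Soundness.
Variables (K : realType) (R : idomainType) (v : nonarch_absval K R).
Notation A := (entire v).
Notation t := (entire_X v).
Notation B := (quad t).
Notation Q := (quad ('X : {poly R})).
Implicit Types (r : K) (a b : B).
Local Notation qu := (qgen t).
Local Notation upow := (qpow t).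

Lemma unorm_upow_sub1 r n : 1 < r -> 0 < n -> unorm r (upow n - 1) = r ^ n.
Proof.
move=> r1 n0; rewrite unorm_dom ?unorm_upow ?unormN ?unorm1 ?(ltW r1)//.
by case: n n0 => // n n0; rewrite exprn_egt1// -lt0n.
Qed.

Lemma unorm_upowN_sub1 r n : 1 < r -> 0 < n -> unorm r (upow (- n) - 1) = 1.
Proof.
move=> r1 n0; rewrite addrC unorm_dom ?unormN ?unorm1 ?unorm_upow ?(ltW r1)//.
case: n n0 => // n n0.
by rewrite -[r ^ - Posz n]invr_expz invf_lt1 ?exprn_egt1 ?exprn_gt0 ?(lt_trans ltr01 r1)// -lt0n.
Qed.

(** The quotient would decrease at infinity like a negative power of u while
    its conjugate has norm 1, against [no_decay]. *)
Lemma qpow_ndvd (m n k : nat) : (0 < m)%N -> (0 < n < k * m)%N ->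
  ~ qdvd ((upow m - 1) ^+ k) (upow n - 1).
Proof.
move=> m0 /andP[n0 nkm] [c cE].
apply: (@no_decay _ _ v c) => r r1; have r1' := ltW r1; have r0 := lt_trans ltr01 r1.
  have /(congr1 (unorm r)) := cE.
  rewrite unormM// unorm_exp// !unorm_upow_sub1// => E.
  have rkm : r ^+ (k * m) != 0 by rewrite expf_neq0// gt_eqF.
  rewrite -(@ler_pM2l _ (r ^+ (k * m))) ?exprn_gt0//.
  have -> : r ^+ (k * m) * unorm r c = r ^+ n by rewrite mulnC exprM.
  by rewrite ler_pdivlMr// -exprSr; apply: ler_weXn2l.
have : qconj (upow n - 1) = qconj ((upow m - 1) ^+ k * c) by rewrite cE.
rewrite qconjM qconjX !qconjB !qconj1 !qpow_conj => /(congr1 (unorm r)).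
by rewrite unormM// unorm_exp// !unorm_upowN_sub1// expr1n mul1r => <-.
Qed.

Lemma qpow_eq1 n : upow n = 1 -> n = 0.
Proof.
move=> n1; have r1 : (1 : K) < 2 by rewrite ltr1n.
have := unorm_upow v n (ltW r1); rewrite n1 unorm1 ?ltW//.
case: n {n1} => [[|n]|n] //= /esym/eqP.
  by rewrite gt_eqF// exprn_egt1.
by rewrite lt_eqF// invf_lt1 ?exprn_egt1 ?exprn_gt0.
Qed.

Lemma qpow_inj : injective upow.
Proof.
move=> m n E; apply/eqP; rewrite -subr_eq0; apply/eqP/qpow_eq1.
by rewrite qpowD E qpowN.
Qed.

(** Euclidean division of exponents reduces the direct implication to a
    remainder smaller than m, which [qpow_ndvd] excludes. *)
Lemma exp_dvd_upow m n : exp_dvd (upow m) (upow n) <-> (m %| n)%Z.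
Proof.
split=> [mn|/dvdzP[k ->]]; last by rewrite mulrC; exact: qdvd_upowM.
have [m0|m0] := eqVneq m 0.
  move: mn => []; rewrite m0 /exp_dvd qpow0 subrr => c; rewrite mul0r => /eqP.
  by rewrite subr_eq0 => /eqP /qpow_eq1 ->.
have {}m0 : (0 < `|m|)%N by rewrite absz_gt0.
have {}mn : qdvd (upow `|m|%N - 1) (upow n - 1).
  by move: mn; rewrite /exp_dvd -[upow m - 1]expr1 => /qdvd_upow_abs.
rewrite dvdzE -[`|m|%N]absz_nat -dvdzE; apply/dvdz_mod0P.
set M := `|m|%N%:Z in mn *.
have M0 : M != 0 by rewrite -absz_gt0.
have rM : (n %% M)%Z = `|(n %% M)%Z|%N%:Z by rewrite gez0_abs// modz_ge0.
apply/eqP/negPn/negP => r0.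
apply: (@qpow_ndvd `|m|%N `|(n %% M)%Z|%N 1); rewrite // ?absz_gt0 ?r0 ?mul1n.
  by have := ltz_mod n M0; rewrite rM; lia.
rewrite expr1 -rM.
have -> : upow (n %% M)%Z - 1 = (upow n - 1) - (upow (M * (n %/ M)%Z) - 1) * upow (n %% M)%Z.
  by rewrite mulrBl mul1r -qpowD mulrC -divz_eq; ring.
by apply: qdvd_sub => //; apply: qdvd_mulr; apply: qdvd_upowM.
Qed.

Lemma exp_pdvd_upow m n : m != 0 -> exp_pdvd (upow m) (upow n) ->
  (m %| n)%Z /\ `|m|%N <> `|n|%N.
Proof.
move=> m0 mn; split.
  apply/exp_dvd_upow; move: mn => [c E]; exists ((upow m - 1) * c).
  by rewrite mulrA -expr2.
move=> E; have M0 : (0 < `|m|)%N by rewrite absz_gt0.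
apply: (@qpow_ndvd `|m|%N `|m|%N 2) => //; first by lia.
have /qdvd_upow_abs [c cE] := mn.
have [nE|nE] : n = `|m|%N%:Z \/ n = - `|m|%N%:Z by lia.
  by exists c; rewrite -cE nE.
exists (- upow (- n) * c); rewrite mulrCA -cE -qpowN_sub1.
by rewrite nE opprK.
Qed.

End Soundness.

(** * Perfect powers in the quadratic extension *)

Section PosChar.
Variables (K : realType) (R : idomainType) (v : nonarch_absval K R).
Variables (p : nat).
Hypothesis pR : p \in [pchar R].
Notation A := (entire v).
Notation t := (entire_X v).
Notation B := (quad t).
Notation Q := (quad ('X : {poly R})).
Implicit Types (r : K) (a b : B).
Local Notation qu := (qgen t).
Local Notation upow := (qpow t).
Local Notation b2 := (p == 2)%N.

Let p_pr : prime p. Proof. exact: pcharf_prime pR. Qed.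

Lemma pchar_entire : p \in [pchar A].
Proof.
rewrite inE p_pr /=; apply/eqP.
transitivity (entire_poly v (p%:R)%:P); first by rewrite polyC_natr rmorph_nat.
by rewrite (pcharf0 pR) polyC0 rmorph0.
Qed.

Lemma pchar_quad : p \in [pchar B].
Proof.
rewrite inE p_pr /=; apply/eqP.
by rewrite -(rmorph_nat (qconst t)) (pcharf0 pchar_entire) rmorph0.
Qed.

Lemma absv_nat_le1 n : v n%:R <= 1.
Proof.
elim: n => [|n IH]; first by rewrite absv0.
rewrite -natr1; apply: le_trans (absv_ultra _ _ _) _.
by rewrite ge_max IH absv1 lexx.
Qed.

(** An integer prime to p has an inverse that is again an integer, and both
    have absolute value at most 1. *)
Lemma absv2 : ~~ b2 -> v 2%:R = 1.
Proof.
move=> p2; have : v 2%:R * v (p.+1./2)%:R = 1.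
  rewrite -absvM -natrM mul2n.
  have -> : (p.+1./2).*2 = p.+1.
    have p_odd : odd p by case: (even_prime p_pr) p2 => [->|].
    by rewrite -[RHS]odd_double_half /= p_odd.
  by rewrite -natr1 (pcharf0 pR) add0r absv1.
move=> E; apply/eqP; rewrite eq_le absv_nat_le1 -E.
by rewrite ler_piMr ?absv_ge0 ?absv_nat_le1.
Qed.

Lemma unorm_nat r n : 1 <= r -> unorm r (n%:R : B) = v n%:R.
Proof.
move=> r1; have r0 : 0 < r := lt_le_trans ltr01 r1.
have -> : n%:R = entire_quad v (qconst _ (n%:R)%:P).
  by rewrite polyC_natr !rmorph_nat.
rewrite unorm_quad// /qnorm /lquad /= rmorph0 mul0r addr0.
by rewrite levalC fnorm_lconst.
Qed.

(** If a were - u^n with 2 nonzero, then u - 1 would divide 2, against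
    [no_decay]. *)
Lemma is_powP a : is_pow a -> exists n, a = upow n.
Proof.
move=> [aa [g gE]]; have [n [->|aE]] := pell aa; first by exists n.
have [p2|p2] := boolP b2.
  exists n; rewrite aE; apply/eqP; rewrite -subr_eq0 -opprD oppr_eq0 -mulr2n -mulr_natl.
  by have := pcharf0 pchar_quad; rewrite (eqP p2) => ->; rewrite mul0r.
have [h hE] : qdvd (qu - 1) (upow n - 1).
  by have := qdvd_upowM t 1 n; rewrite mul1r qpow1.
have E : - 2%:R = (qu - 1) * (g + h).
  by rewrite mulrDr -hE -gE aE; ring.
exfalso; apply: (@no_decay _ _ v (g + h)) => r r1; have r1' := ltW r1.
  have := congr1 (unorm r) E.
  rewrite unormM// -[qu]qpow1 unorm_upow_sub1// unormN// unorm_nat// absv2// => E1.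
  have r0 : r != 0 by rewrite gt_eqF// (lt_trans ltr01).
  by rewrite -[unorm r _](mulKf r0) -[r in _ * (r * _)]expr1 -E1 mulr1.
have : qconj (- 2%:R) = qconj ((qu - 1) * (g + h)) by rewrite E.
rewrite qconjM qconjN qconjB qconj1 -[qu]qpow1 qpow_conj => /(congr1 (unorm r)).
have -> : qconj (2%:R : B) = 2%:R by rewrite (rmorph_nat (@qconj _ t)).
by rewrite unormM// unorm_upowN_sub1// unormN// unorm_nat// absv2// mul1r.
Qed.

Lemma is_pow_upow n : is_pow (upow n).
Proof.
split; first by rewrite qpow_conj qpowN.
by have := qdvd_upowM t 1 n; rewrite mul1r qpow1.
Qed.

Lemma exp_pdvd_pow m s : (0 < s)%N -> exp_pdvd (upow m) (upow (m * (p ^ s)%N)).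
Proof.
move=> s0; rewrite -qpowXn /exp_pdvd.
have -> : upow m ^+ (p ^ s) - 1 = (upow m - 1) ^+ (p ^ s).
  have pn : ([pchar B]).-nat (p ^ s)%N by rewrite pnatX pnatE// pchar_quad.
  by rewrite -{1}[upow m](subrK 1) (exprDn_pchar _ _ pn) expr1n addrK.
have p2 : (2 <= p ^ s)%N.
  apply: leq_trans (prime_gt1 p_pr) _; rewrite -[X in (X <= _)%N]expn1.
  by apply: leq_pexp2l => //; exact: prime_gt0.
rewrite -(subnKC p2) exprD; apply: qdvd_mulr; exact: qdvd_refl.
Qed.

(** The Frobenius map gives the power p^s of the same factor, and the total
    exponent 1 + p^s is even for p odd; for p = 2 one of 1 + 2^s and 2 + 2^s is a
    multiple of 3. *)
Lemma exp_sim_pow m s : exp_sim (upow m) (upow (m * (p ^ s)%N)).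
Proof.
rewrite -qpowXn /exp_sim !(cycl_frobenius _ _ _ pchar_quad).
have [p2|p2] := boolP b2; [right|left].
  split; first by have := pcharf0 pchar_entire; rewrite (eqP p2) mulr2n.
  have : ((p ^ s)%N = 1 %[mod 3] \/ (p ^ s)%N = 2 %[mod 3])%N.
    rewrite (eqP p2); elim: s => [|s IH]; first by left.
    by rewrite expnS -modnMmr; case: IH => ->; [right|left].
  set N := (p ^ s)%N; move=> [E|E]; [right|left].
    exists (cycl true (upow m) ^+ ((N + 2) %/ 3)).
    by rewrite -exprM -exprD; congr (_ ^+ _); lia.
  exists (cycl true (upow m) ^+ ((N + 1) %/ 3)).
  by rewrite -exprM -exprS; congr (_ ^+ _); lia.
have p_odd : odd p by case: (even_prime p_pr) p2 => [->|].
split.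
  exists (p.+1./2)%:R; rewrite -natrD addnn.
  have -> : (p.+1./2).*2 = p.+1 by rewrite -[RHS]odd_double_half /= p_odd.
  by rewrite -natr1 (pcharf0 pchar_entire) add0r.
exists (cycl false (upow m) ^+ ((p ^ s).+1./2)).
rewrite -exprM -exprS muln2; congr (_ ^+ _).
by rewrite -[LHS]odd_double_half /= oddX p_odd orbT.
Qed.

Lemma unorm_cycl_le r (b : bool) n : 1 <= r -> unorm r (cycl b (upow n)) <= r ^+ (2 * `|n|).
Proof.
move=> r1; have r0 : 0 < r := lt_le_trans ltr01 r1.
have M1 k : 1 <= r ^+ k by rewrite exprn_ege1.
have Wn : unorm r (upow n) <= r ^+ `|n|.
  rewrite unorm_upow//; case: n => n //.
  apply: (@le_trans _ _ 1); last exact: M1.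
  by rewrite /= invf_le1 ?exprn_gt0.
have Wn2 : unorm r (upow n) <= r ^+ (2 * `|n|).
  by apply: le_trans Wn _; apply: ler_weXn2l => //; lia.
have s1 : unorm r (upow n + 1) <= r ^+ (2 * `|n|).
  by apply: le_trans (unormD r1 _ _) _; rewrite ge_max Wn2 unorm1// M1.
rewrite /cycl; case: b; last exact: s1.
rewrite -addrA; apply: le_trans (unormD r1 _ _) _.
by rewrite ge_max s1 andbT unorm_exp// mulnC exprM lerXn2r ?nnegrE ?unorm_ge0 ?exprn_ge0 ?(ltW r0).
Qed.

(** Taking roots preserves polynomial growth, so that z is a polynomial. *)
Lemma root_is_poly (z w : B) k d : (0 < k)%N -> z ^+ k = w ->
  (forall r, 1 <= r -> unorm r w <= r ^+ d) ->
  (forall r, 1 <= r -> unorm r (qconj w) <= r ^+ d) ->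
  exists z' : Q, z = entire_quad v z'.
Proof.
move=> k0 zw wd cwd.
have root_le (x y : K) : 0 <= x -> 1 <= y -> x ^+ k <= y -> x <= y.
  move=> x0 y1 xy; case: (leP x 1) => [x1|x1]; first exact: le_trans y1.
  by apply: le_trans xy; rewrite -{1}[x]expr1; apply: ler_weXn2l => //; exact: ltW.
have r1 m : (1 : K) <= 2 ^+ (2 ^ m)%N by rewrite exprn_ege1// ler1n.
apply: (@quad_bounded_poly _ _ v z 1 d) => m; rewrite mul1r.
- apply: root_le; [exact: unorm_ge0|exact: exprn_ege1|].
  by rewrite -unorm_exp// zw wd.
- apply: root_le; [exact: unorm_ge0|exact: exprn_ege1|].
  by rewrite -unorm_exp// -qconjX zw cwd.
Qed.

Lemma lquad_upow n :
  lquad (qpow ('X : {poly R}) n) = lX R ^ n.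
Proof.
case: n => n.
  transitivity (lquad (qgen ('X : {poly R})) ^+ n); first exact: rmorphXn.
  by rewrite lquad_u.
transitivity (lquad (qconj (qgen ('X : {poly R}))) ^+ n.+1).
  exact: rmorphXn.
by rewrite lquad_conj_u exprVn.
Qed.

Lemma lquad_cycl (b : bool) n : exists e,
  lquad (cycl b (qpow ('X : {poly R}) n)) * lX R ^+ e =
  FracField.tofrac (cycl b ('X^`|n|%N : {poly R})).
Proof.
have -> : lquad (cycl b (qpow ('X : {poly R}) n)) = cycl b (lX R ^ n).
  by rewrite -lquad_upow; exact: rmorph_cycl.
have -> k : FracField.tofrac (cycl b ('X^k : {poly R})) = cycl b (lX R ^+ k).
  by rewrite -[lX R ^+ k](rmorphXn (@FracField.tofrac _)); exact: rmorph_cycl.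
case: n => n; first by exists 0%N; rewrite mulr1.
exists (n.+1 * (1 + b))%N; rewrite exprM -[lX R ^ Negz n]/((lX R ^+ n.+1)^-1) /=.
have : lX R ^+ n.+1 != 0 by rewrite expf_neq0// lX_neq0.
exact: cyclV.
Qed.

(** Descends an identity of B to polynomials in one variable: the root is a
    polynomial in t and u, and X is substituted for u, up to powers of X. *)
Lemma cycl_power_upow (i j : nat) m n (z : B) :
  cycl b2 (upow m) ^+ i * cycl b2 (upow n) ^+ j = z ^+ (2 + b2) ->
  exists e (H : {poly {fraction R}}),
    cycl b2 'X^`|m| ^+ i * cycl b2 'X^`|n| ^+ j * 'X^e = H ^+ (2 + b2).
Proof.
move=> E; pose k := (2 + b2)%N.
pose d := (2 * `|m| * i + 2 * `|n| * j)%N.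
have bound r m' n' : 1 <= r ->
    unorm r (cycl b2 (upow m') ^+ i * cycl b2 (upow n') ^+ j) <=
    r ^+ (2 * `|m'| * i + 2 * `|n'| * j).
  move=> r1; rewrite unormM// !unorm_exp// exprD [r ^+ (_ * i)]exprM [r ^+ (_ * j)]exprM.
  have r0 : 0 <= r by exact: le_trans r1.
  have le m'' i'' : unorm r (cycl b2 (upow m'')) ^+ i'' <= (r ^+ (2 * `|m''|)) ^+ i''.
    apply: lerXn2r; rewrite ?nnegrE; [exact: unorm_ge0|exact: exprn_ge0|exact: unorm_cycl_le].
  by apply: ler_pM; rewrite ?le//; apply: exprn_ge0; exact: unorm_ge0.
have [|||z' z'E] := @root_is_poly z _ k d _ (esym E).
- by [].
- by move=> r r1; exact: bound.
- move=> r r1; rewrite qconjM !qconjX.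
  have c m' : qconj (cycl b2 (upow m')) = cycl b2 (upow (- m')).
    by rewrite -qpow_conj; exact: rmorph_cycl.
  by rewrite !c; apply: le_trans (bound r _ _ r1) _; rewrite !abszN.
pose x := cycl b2 (qpow ('X : {poly R}) m).
pose y := cycl b2 (qpow ('X : {poly R}) n).
have Ec m' : entire_quad v (cycl b2 (qpow 'X m')) = cycl b2 (upow m').
  by rewrite -entire_quad_upow; exact: rmorph_cycl.
have E' : x ^+ i * y ^+ j = z' ^+ k.
  apply: (@entire_quad_inj _ _ v).
  transitivity (entire_quad v x ^+ i * entire_quad v y ^+ j).
    have <- : entire_quad v (x ^+ i) = entire_quad v x ^+ i by exact: rmorphXn.
    have <- : entire_quad v (y ^+ j) = entire_quad v y ^+ j by exact: rmorphXn.
    exact: rmorphM.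
  transitivity (entire_quad v z' ^+ k); last by apply/esym; exact: rmorphXn.
  by rewrite /x /y (Ec m) (Ec n) E -z'E.
have EL : lquad x ^+ i * lquad y ^+ j = lquad z' ^+ k.
  have <- : lquad (z' ^+ k) = lquad z' ^+ k by exact: rmorphXn.
  have <- : lquad (x ^+ i) = lquad x ^+ i by exact: rmorphXn.
  have <- : lquad (y ^+ j) = lquad y ^+ j by exact: rmorphXn.
  rewrite -E'.
  by apply/esym; exact: rmorphM.
have [e1 E1] := lquad_cycl b2 m; have [e2 E2] := lquad_cycl b2 n.
have [D [G GE]] := lquad_laurent z'.
(* Clearing denominators costs X^M on one side; a further factor X^(M (k - 1))
   makes it a k-th power. *)
pose M := (e1 * i + e2 * j)%N; pose e := (D * k + M * k.-1)%N.
have PE : cycl b2 'X^`|m| ^+ i * cycl b2 'X^`|n| ^+ j * 'X^e = (G * 'X^M) ^+ k.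
  apply/eqP; rewrite -tofrac_eq; apply/eqP.
  have tX d' : FracField.tofrac ('X^d' : {poly R}) = lX R ^+ d' by exact: tofracXn.
  rewrite tofracM tofracM !tofracXn tofracM -E1 -E2 -GE -/x -/y.
  rewrite !exprMn -!exprM -EL /e.
  rewrite tX -exprM; have -> : (M * k = M + M * k.-1)%N by rewrite -mulnS.
  by rewrite !exprD; ring.
exists e, (map_poly (@FracField.tofrac R) (G * 'X^M)).
have Fc (P : {poly R}) : map_poly (@FracField.tofrac R) (cycl b2 P) =
    cycl b2 (map_poly (@FracField.tofrac R) P) by exact: rmorph_cycl.
rewrite -/k; move: PE; move: (k) (e) => k' e' PE.
have /(congr1 (map_poly (@FracField.tofrac R))) := PE.
by rewrite !(rmorphM, rmorphXn) /= !Fc !rmorphXn /= !map_polyX.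
Qed.

Lemma exp_sim_dir (i j : nat) m n (z : B) : ~~ ((2 + b2) %| i)%N ->
  m != 0 -> cycl b2 (upow m) ^+ i * cycl b2 (upow n) ^+ j = z ^+ (2 + b2) ->
  n != 0 /\ ((`|m|%N)`_p^' <= (`|n|%N)`_p^')%N.
Proof.
move=> ki m0 E; have [e [H HE]] := cycl_power_upow E.
have pF : p \in [pchar {fraction R}].
  rewrite inE p_pr /=; apply/eqP.
  by rewrite -(rmorph_nat (@FracField.tofrac R)) (pcharf0 pR) rmorph0.
have [|n0 mn] := @cycl_power_dir _ p pF `|m|%N `|n|%N i j e H _ ki HE.
- by rewrite absz_gt0.
by split=> //; rewrite -absz_gt0.
Qed.

(** Both inequalities between prime-to-p parts are instances of
    [exp_sim_dir], because the two factors play symmetric roles. *)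
Lemma exp_sim_upow m n : exp_sim (upow m) (upow n) ->
  (m == 0) = (n == 0) /\ (m != 0 -> (`|m|%N)`_p^' = (`|n|%N)`_p^')%N.
Proof.
move=> mn.
suff [d1 d2] : (m != 0 -> n != 0 /\ ((`|m|%N)`_p^' <= (`|n|%N)`_p^')%N) /\
    (n != 0 -> m != 0 /\ ((`|n|%N)`_p^' <= (`|m|%N)`_p^')%N).
  split.
    by apply/eqP/eqP => z; apply/eqP/negPn/negP; [move/d2|move/d1]; rewrite z eqxx => -[].
  move=> m0; have [n0 le] := d1 m0; have [_ ge] := d2 n0.
  by apply/eqP; rewrite eqn_leq le ge.
have twoA : (1 + 1 : A) = 0 -> b2.
  move=> A2; have /eqP := A2; rewrite -mulr2n -(dvdn_pcharf pchar_entire).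
  by rewrite dvdn_prime2.
case: mn => [[[c cc] [z E]]|[/twoA p2 zE]].
  have p2 : b2 = false.
    apply/negP => /eqP p2; have := pcharf0 pchar_entire; rewrite p2 => A2.
    have /eqP : c + c = 0 by rewrite -mulr2n -mulr_natl A2 mul0r.
    by rewrite cc oner_eq0.
  split=> ?.
    by apply: (@exp_sim_dir 1 1 m n z); rewrite // p2 ?expr1.
  by apply: (@exp_sim_dir 1 1 n m z); rewrite // p2 ?expr1// mulrC.
case: zE => -[z E].
  split=> ?.
    by apply: (@exp_sim_dir 1 1 m n z); rewrite // p2 ?expr1.
  by apply: (@exp_sim_dir 1 1 n m z); rewrite // p2 ?expr1// mulrC.
split=> ?.
  by apply: (@exp_sim_dir 2 1 m n z); rewrite // p2 ?expr1.
by apply: (@exp_sim_dir 1 2 n m z); rewrite // p2 ?expr1// mulrC.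
Qed.

End PosChar.

(** * Arithmetic of exponents *)

Section Definable.
Variables (S : comNzRingType) (t : S).
Implicit Types (a b c q : quad t).

(** This holds for the exponents p^s and forces an exponent to be p^s up to
    sign. *)
Definition is_ppow a := exp_sim (qgen t) a.

(** Bounds the exponent of a by twice that of q: the exponent of a divides
    a nonzero difference of two numbers that are powers of p up to sign and
    divide the nonzero exponent of q. *)
Definition exp_small a q := exists b c, (is_pow b /\ is_pow c) /\
  (is_ppow b /\ is_ppow c) /\ exp_pdvd b c /\
  (exp_dvd a (c * qconj b) /\ exp_dvd c q).

(** In terms of the exponents, which are q = p^s and b = q^2: the numbers q - 1
    and b - q differ by the factor p^s. *)
Definition ppow_sqr q b := (is_ppow q /\ is_ppow b) /\
  (exp_pdvd q b /\ exp_sim (q * qconj (qgen t)) (b * qconj q)).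

(** The numbers 11 (2 a + 1) and 11 (2 b + 1) are never 0, so that the
    size condition can always be met, and the factor 11 makes the bound strong
    enough for the final comparison.  The exponents of q0, q1, q2 are q, q^2, q^4. *)
Definition exp_sqr a b := exists q0 q1 q2,
  (is_pow q0 /\ is_pow q1 /\ is_pow q2) /\
  (exp_small ((a ^+ 2 * qgen t) ^+ 11) q0 /\ exp_small ((b ^+ 2 * qgen t) ^+ 11) q0) /\
  (ppow_sqr q0 q1 /\ ppow_sqr q1 q2) /\
  exp_dvd (q1 * qconj a) (q2 * qconj b).

Definition exp_mul a b c := exists a2 b2 ab2,
  (is_pow a2 /\ is_pow b2 /\ is_pow ab2) /\
  (exp_sqr a a2 /\ exp_sqr b b2 /\ exp_sqr (a * b) ab2) /\
  ab2 = a2 * b2 * c ^+ 2.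

End Definable.

(** Modulo q^2 - a the number q^4 - b is a^2 - b, and the bounds make a^2 - b
    smaller than q^2 - a. *)
Lemma sqr_int (a b q : int) :
  (`|((2 * a + 1) * 11)%R| <= 2 * `|q|)%N -> (`|((2 * b + 1) * 11)%R| <= 2 * `|q|)%N ->
  (q ^+ 2 - a %| (q ^+ 2) ^+ 2 - b)%Z -> b = a ^+ 2.
Proof.
move=> aq bq dv.
have {}dv : (q ^+ 2 - a %| a ^+ 2 - b)%Z.
  have -> : a ^+ 2 - b = ((q ^+ 2) ^+ 2 - b) - (q ^+ 2 - a) * (q ^+ 2 + a) by ring.
  by apply: rpredB => //; apply: dvdz_mulr.
apply/eqP; rewrite eq_sym -subr_eq0; apply/negPn/negP => ab.
have : (`|(q ^+ 2 - a)%R| <= `|(a ^+ 2 - b)%R|)%N.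
  by apply: dvdn_leq; rewrite ?absz_gt0// -dvdzE.
have q6 : (6 <= `|q|)%N by lia.
have a5 : (5 * `|a| <= `|q|)%N by lia.
have b5 : (5 * `|b| <= `|q|)%N by lia.
rewrite leqNgt => /negP; apply.
have [a2 q2] : `|a ^+ 2|%N = (`|a| * `|a|)%N /\ `|q ^+ 2|%N = (`|q| * `|q|)%N.
  by rewrite !expr2 !abszM.
have aq2 : (25 * (`|a| * `|a|) <= `|q| * `|q|)%N.
  by rewrite (_ : 25 = 5 * 5)%N// mulnACA leq_mul.
have q62 : (6 * `|q| <= `|q| * `|q|)%N by rewrite leq_mul2r q6 orbT.
move: (a ^+ 2) (q ^+ 2) a2 q2 => x y; move: aq2 q62.
move: (`|a| * `|a|)%N (`|q| * `|q|)%N => x' y'.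
clear -q6 a5 b5; lia.
Qed.

Section Arithmetic.
Variables (p : nat).
Hypothesis p_pr : prime p.

Lemma ppart_eq1 (n : nat) : (0 < n)%N -> (n`_p^' = 1)%N -> exists s, n = (p ^ s)%N.
Proof. by move=> n0 n1; exists (logn p n); rewrite -p_part -[LHS](partnC p n0) n1 muln1. Qed.

(** The smaller of two powers of p divides their difference. *)
Lemma sub2_ppow (i j : nat) : (p ^ i = p ^ j + 2)%N -> (p ^ j <= 2)%N.
Proof.
move=> E; have ji : (j <= i)%N.
  by rewrite -(leq_exp2l _ _ (prime_gt1 p_pr)) E leq_addr.
have : (p ^ j %| p ^ j + 2)%N by rewrite -E dvdn_exp2l.
by rewrite dvdn_addr// => /dvdn_leq; apply.
Qed.

Lemma ppart_coprime (n : nat) : (0 < n)%N -> ~~ (p %| n)%N -> (n`_p^')%N = n.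
Proof.
move=> n0 pn; rewrite part_pnat_id//; apply/pnatP => // q q_pr qn.
by apply: contra pn; rewrite inE => /eqP <-.
Qed.

(** Here b = c q with c, up to sign, a power of p other than 1.  The
    prime-to-p parts of q - 1 and of b - q = q (c - 1) are q - 1 and c - 1 up to
    sign, so that c = q or c = 2 - q; the latter makes two powers of p differ by
    2 and forces q to be at most 4 in absolute value. *)
Lemma ppow_sqr_int (q b : int) (s e : nat) : (4 < `|q|)%N ->
  `|q|%N = (p ^ s)%N -> `|b|%N = (p ^ e)%N -> (q %| b)%Z -> `|q|%N <> `|b|%N ->
  (q - 1 == 0) = (b - q == 0) ->
  (q - 1 != 0 -> ((`|q - 1|%N)`_p^' = (`|b - q|%N)`_p^')%N) -> b = q ^+ 2.
Proof.
move=> q4 qs be /dvdzP[c bE] qb z0 part.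
have q0 : (0 < `|q|)%N by apply: leq_trans q4.
have q10 : q - 1 != 0 by lia.
have bq0 : b - q != 0 by rewrite -z0.
have cE : `|b|%N = (`|c| * `|q|)%N by rewrite bE abszM.
have se : (s <= e)%N.
  rewrite -(leq_exp2l _ _ (prime_gt1 p_pr)) -qs -be cE leq_pmull// lt0n.
  apply/eqP => c0; move: be; rewrite cE c0 mul0n => /esym/eqP.
  by rewrite expn_eq0 -leqn0 leqNgt prime_gt0.
have cf : `|c|%N = (p ^ (e - s))%N.
  by apply/eqP; rewrite -(eqn_pmul2r q0) -cE be qs -expnD subnK.
have f0 : (0 < e - s)%N.
  rewrite lt0n; apply/eqP => f0; apply: qb; rewrite cE cf f0 expn0 mul1n.
  by [].
have s0 : (0 < s)%N by rewrite lt0n; apply/eqP => s0; move: q4; rewrite qs s0.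
have pdvd (x : int) k : (0 < k)%N -> `|x|%N = (p ^ k)%N -> ~~ (p %| `|(x - 1)%R|)%N.
  move=> k0 xk; apply/negP => px1.
  have px : (p %| `|x|)%N by rewrite xk dvdn_exp.
  have /(dvdn_leq (ltn0Sn 0)) : (p %| 1)%N.
    have : (Posz p %| x - (x - 1))%Z by apply: rpredB; rewrite dvdzE.
    by rewrite opprB addrCA subrr addr0 dvdzE.
  by rewrite leqNgt prime_gt1.
have c10 : (0 < `|(c - 1)%R|)%N.
  rewrite absz_gt0; apply: contraNneq bq0 => c1.
  by rewrite bE -[q in _ - q]mul1r -mulrBl c1 mul0r.
have E : `|q - 1|%N = `|c - 1|%N.
  have := part q10; rewrite ppart_coprime ?absz_gt0//; last exact: (pdvd q s).
  have -> : b - q = q * (c - 1) by rewrite bE; ring.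
  rewrite abszM partnM// [X in (X * _)%N](_ : _ = 1%N); last first.
    by rewrite qs part_p'nat ?pnatNK// pnatX pnatE// inE eqxx.
  by rewrite mul1n ppart_coprime// (pdvd c (e - s)%N).
have [cq|c2] : c = q \/ c = 2 - q by lia.
  by rewrite bE cq expr2.
exfalso; case: (ltrP 0 q) => q_sg.
  have := @sub2_ppow s (e - s); rewrite -qs -cf => H.
  have : (`|c| <= 2)%N by apply: H; lia.
  by lia.
have := @sub2_ppow (e - s) s; rewrite -qs -cf => H.
have : (`|q| <= 2)%N by apply: H; lia.
by lia.
Qed.

(** Euler's theorem for the prime-to-p part of a. *)
Lemma dvd_ppow_sub (a : int) : a != 0 ->
  exists i j, (0 < j)%N /\ (a %| (p ^ (i + j))%N%:Z - (p ^ i)%N%:Z)%Z.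
Proof.
move=> a0; have n0 : (0 < `|a|)%N by rewrite absz_gt0.
pose m := ((`|a|%N)`_p^')%N; have m0 : (0 < m)%N by rewrite part_gt0.
exists (logn p `|a|), (totient m); split; first by rewrite totient_gt0.
have pm : coprime p m.
  by rewrite prime_coprime// -p'natE// part_pnat.
rewrite subzn ?leq_exp2l ?prime_gt1 ?leq_addr// dvdzE !absz_nat.
rewrite -[in X in (X %| _)%N](partnC p n0) p_part expnD -[X in (_ - X)%N]muln1 -mulnBr.
rewrite dvdn_mul// -eqn_mod_dvd ?expn_gt0 ?prime_gt0//.
by apply/eqP; rewrite Euler_exp_totient.
Qed.

End Arithmetic.

Section Interpretation.
Variables (K : realType) (R : idomainType) (v : nonarch_absval K R).
Variables (p : nat).
Hypothesis pR : p \in [pchar R].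
Notation t := (entire_X v).
Local Notation upow := (qpow t).
Let p_pr : prime p. Proof. exact: pcharf_prime pR. Qed.

Lemma is_ppow_upow n : is_ppow (upow n) -> exists s, `|n|%N = (p ^ s)%N.
Proof.
rewrite /is_ppow -(qpow1 t) => /(exp_sim_upow pR)[n0 /(_ isT) E]; apply: ppart_eq1 => //.
  by rewrite absz_gt0 -n0.
rewrite -E; apply/eqP; rewrite -dvdn1 -[X in (_ %| X)%N](partnC p (ltn0Sn 0)).
exact: dvdn_mull.
Qed.

Lemma is_ppow_pow s : is_ppow (upow (p ^ s)%N).
Proof. by have := exp_sim_pow v pR 1 s; rewrite mul1r. Qed.

Lemma is_ppow_neq0 n : is_ppow (upow n) -> n != 0.
Proof.
move=> /is_ppow_upow[s nE].
by rewrite -absz_gt0 nE expn_gt0 prime_gt0.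
Qed.

Lemma qpow_subE m n : upow m * qconj (upow n) = upow (m - n).
Proof. by rewrite qpow_conj qpowD. Qed.

Lemma exp_small_le a q : q != 0 -> exp_small (upow a) (upow q) ->
  (`|a| <= 2 * `|q|)%N.
Proof.
move=> q0 [b' [c' [[/(is_powP pR)[b ->] /(is_powP pR)[c ->]] [[pb pc] [bc]]]]].
rewrite qpow_subE => -[/exp_dvd_upow ac /exp_dvd_upow cq].
have [bc1 bc2] := exp_pdvd_upow (is_ppow_neq0 pb) bc.
have cb : c - b != 0 by rewrite subr_eq0; apply/eqP => cb; apply: bc2; rewrite cb.
have acb : (`|a| <= `|(c - b)%R|)%N.
  by apply: dvdn_leq; rewrite ?absz_gt0// -dvdzE.
have bc_le : (`|b| <= `|c|)%N.
  by apply: dvdn_leq; rewrite ?absz_gt0 ?is_ppow_neq0// -dvdzE.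
have cq_le : (`|c| <= `|q|)%N by apply: dvdn_leq; rewrite ?absz_gt0// -dvdzE.
lia.
Qed.

Lemma exp_small_pow (a : int) : a != 0 -> exists s0, forall s, (s0 <= s)%N ->
  exp_small (upow a) (upow (p ^ s)%N).
Proof.
move=> /(dvd_ppow_sub p_pr)[i [j [j0 aij]]]; exists (i + j)%N => s ijs.
exists (upow (p ^ i)%N), (upow (p ^ (i + j))%N).
split; first by split; exact: is_pow_upow.
split; first by split; exact: is_ppow_pow.
split.
  by have := exp_pdvd_pow v pR (p ^ i)%N j0; rewrite -PoszM -expnD.
rewrite qpow_subE; split; first exact/exp_dvd_upow.
by apply/exp_dvd_upow; rewrite dvdzE !absz_nat dvdn_exp2l.
Qed.

Lemma ppow_sqr_upow q b : (4 < `|q|)%N -> ppow_sqr (upow q) (upow b) -> b = q ^+ 2.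
Proof.
move=> q4 [[pq pb] [qb]]; rewrite -qpow1 !qpow_subE => /(exp_sim_upow pR)[z0 part].
have [s qs] := is_ppow_upow pq; have [e be] := is_ppow_upow pb.
have [qb1 qb2] := exp_pdvd_upow (is_ppow_neq0 pq) qb.
exact: (ppow_sqr_int p_pr q4 qs be).
Qed.

Lemma ppow_sqr_pow s : (0 < s)%N ->
  ppow_sqr (upow (p ^ s)%N) (upow (p ^ (s + s))%N).
Proof.
move=> s0; split; first by split; exact: is_ppow_pow.
have E : (p ^ (s + s))%N = (p ^ s)%N%:Z * (p ^ s)%N :> int by rewrite expnD PoszM.
split; first by rewrite E; exact: exp_pdvd_pow.
rewrite -qpow1 !qpow_subE E.
have -> : (p ^ s)%N%:Z * (p ^ s)%N%:Z - (p ^ s)%N%:Z =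
    ((p ^ s)%N%:Z - 1) * (p ^ s)%N%:Z by ring.
exact: exp_sim_pow.
Qed.

Lemma odd_code a : (upow a ^+ 2 * qgen t) ^+ 11 = upow ((2 * a + 1) * 11).
Proof. by rewrite -{1}(qpow1 t) !qpowXn -qpowD qpowXn mulrC; congr upow; ring. Qed.

Lemma exp_sqr_upow a b : exp_sqr (upow a) (upow b) <-> b = a ^+ 2.
Proof.
split.
  move=> [q0' [q1' [q2' [[/(is_powP pR)[q0 ->] [/(is_powP pR)[q1 ->] /(is_powP pR)[q2 ->]]]]]]].
  move=> [[]]; rewrite !odd_code !qpow_subE => aq bq [[s1 s2] /exp_dvd_upow dv].
  have q00 : q0 != 0 by case: s1 => -[/is_ppow_neq0].
  have aq' := exp_small_le q00 aq; have bq' := exp_small_le q00 bq.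
  have q06 : (6 <= `|q0|)%N by lia.
  have q1E : q1 = q0 ^+ 2 by apply: ppow_sqr_upow s1; lia.
  have q2E : q2 = q1 ^+ 2.
    apply: ppow_sqr_upow s2; rewrite q1E expr2 abszM.
    have := leq_mul q06 q06; lia.
  by apply: (sqr_int aq' bq'); rewrite -q1E -q2E.
move=> ->.
have [|sa saP] := @exp_small_pow ((2 * a + 1) * 11); first by lia.
have [|sb sbP] := @exp_small_pow ((2 * a ^+ 2 + 1) * 11); first by lia.
pose s := (sa + sb).+1.
exists (upow (p ^ s)%N), (upow (p ^ (s + s))%N), (upow (p ^ (s + s + (s + s)))%N).
split; first by split; [|split]; exact: is_pow_upow.
split; first by rewrite !odd_code; split; [apply: saP|apply: sbP]; rewrite /s; lia.
split; first by split; apply: ppow_sqr_pow.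
rewrite !qpow_subE; apply/exp_dvd_upow.
rewrite expnD PoszM -expr2 subr_sqr; exact: dvdz_mulr.
Qed.

Lemma exp_mul_upow a b c : exp_mul (upow a) (upow b) (upow c) <-> c = a * b.
Proof.
split.
  move=> [x' [y' [z' [[/(is_powP pR)[x ->] [/(is_powP pR)[y ->] /(is_powP pR)[z ->]]]]]]].
  rewrite -qpowD => -[[/exp_sqr_upow -> [/exp_sqr_upow -> /exp_sqr_upow ->]]].
  rewrite qpowXn -!qpowD => /qpow_inj.
  by rewrite sqrrD mulr2n => E; lia.
move=> ->; exists (upow (a ^+ 2)), (upow (b ^+ 2)), (upow ((a + b) ^+ 2)).
split; first by split; [|split]; exact: is_pow_upow.
split; first by rewrite -qpowD; split; [|split]; exact/exp_sqr_upow.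
by rewrite qpowXn -!qpowD; congr upow; ring.
Qed.

End Interpretation.

(** * Positive existential definability *)

Definition ring_fun (V : Type) := forall (S : comNzRingType) (t : S), (V -> S) -> S.
Definition quad_fun (V : Type) :=
  forall (S : comNzRingType) (t : S), (V -> S) -> quad t.
Definition ring_prop (V : Type) :=
  forall (S : comNzRingType) (t : S), (V -> S) -> Prop.

(** One formula serves all rings S and all interpretations of t, which is
    the uniformity to be established. *)
Definition pe_definable V (P : ring_prop V) := exists phi : formula L_t V,
  positive_existential phi /\
  forall (S : comNzRingType) (t : S) (e : V -> S),
    sat (ring_t_structure t) phi e <-> P S t e.

(** The language has no subtraction; polynomial functions with integer
    coefficients are differences of two terms. *)
Definition term_fun V (f : ring_fun V) := exists u1 u2 : term L_t V,
  forall (S : comNzRingType) (t : S) (e : V -> S),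
    f S t e = Defs.eval (ring_t_structure t) e u1 - Defs.eval (ring_t_structure t) e u2.

Definition term_quad V (F : quad_fun V) :=
  term_fun (fun S t e => qre (F S t e)) /\ term_fun (fun S t e => qim (F S t e)).

Section Terms.
Variable V : Type.
Implicit Types (f g : ring_fun V) (F G : quad_fun V).

Definition op2 (o : ring_fn) (a b : term L_t V) : term L_t V :=
  @App L_t V o (fun i : 'I_2 => if i == ord0 then a else b).

Lemma term_fun_var x : term_fun (fun S t (e : V -> S) => e x).
Proof. by exists (@Var L_t V x), (@Cst L_t V Zero_t) => S t e /=; rewrite subr0. Qed.

Lemma term_fun0 : term_fun (fun S t (e : V -> S) => 0).
Proof. by exists (@Cst L_t V Zero_t), (@Cst L_t V Zero_t) => S t e /=; rewrite subr0. Qed.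

Lemma term_fun1 : term_fun (fun S t (e : V -> S) => 1).
Proof. by exists (@Cst L_t V One_t), (@Cst L_t V Zero_t) => S t e /=; rewrite subr0. Qed.

Lemma term_funT : term_fun (fun S t (e : V -> S) => t).
Proof. by exists (@Cst L_t V T_t), (@Cst L_t V Zero_t) => S t e /=; rewrite subr0. Qed.

Lemma term_funD f g : term_fun f -> term_fun g ->
  term_fun (fun S t e => f S t e + g S t e).
Proof.
move=> [f1 [f2 fE]] [g1 [g2 gE]]; exists (op2 Add f1 g1), (op2 Add f2 g2) => S t e.
by rewrite fE gE /=; ring.
Qed.

Lemma term_funN f : term_fun f -> term_fun (fun S t e => - f S t e).
Proof. by move=> [f1 [f2 fE]]; exists f2, f1 => S t e; rewrite fE opprB. Qed.

Lemma term_funM f g : term_fun f -> term_fun g ->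
  term_fun (fun S t e => f S t e * g S t e).
Proof.
move=> [f1 [f2 fE]] [g1 [g2 gE]].
exists (op2 Add (op2 Mul f1 g1) (op2 Mul f2 g2)),
  (op2 Add (op2 Mul f1 g2) (op2 Mul f2 g1)) => S t e.
by rewrite fE gE /=; ring.
Qed.

Lemma term_quad_var x y : term_quad (fun S t (e : V -> S) => Quad t (e x) (e y)).
Proof. by split; exact: term_fun_var. Qed.

Lemma term_quad1 : term_quad (fun S t (e : V -> S) => 1).
Proof. by split; [exact: term_fun1|exact: term_fun0]. Qed.

Lemma term_quad_u : term_quad (fun S t (e : V -> S) => qgen t).
Proof. by split; [exact: term_fun0|exact: term_fun1]. Qed.

Lemma term_quadD F G : term_quad F -> term_quad G ->
  term_quad (fun S t e => F S t e + G S t e).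
Proof. by move=> [? ?] [? ?]; split; apply: term_funD. Qed.

Lemma term_quadN F : term_quad F -> term_quad (fun S t e => - F S t e).
Proof. by move=> [? ?]; split; apply: term_funN. Qed.

Lemma term_quadM F G : term_quad F -> term_quad G ->
  term_quad (fun S t e => F S t e * G S t e).
Proof.
move=> [F1 F2] [G1 G2]; split.
  by apply: term_funD; [apply: term_funM|apply: term_funN; apply: term_funM].
apply: term_funD; first by apply: term_funD; apply: term_funM.
by apply: term_funM; [exact: term_funT|apply: term_funM].
Qed.

Lemma term_quadX F n : term_quad F -> term_quad (fun S t e => F S t e ^+ n).
Proof.
move=> hF; elim: n => [|[|n] IH]; [exact: term_quad1|exact: hF|].
exact: (term_quadM hF IH).
Qed.

Lemma term_quad_conj F : term_quad F -> term_quad (fun S t e => qconj (F S t e)).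
Proof.
move=> [F1 F2]; split; last exact: term_funN.
by apply: term_funD => //; apply: term_funM => //; exact: term_funT.
Qed.

Lemma term_quad_cycl b F : term_quad F -> term_quad (fun S t e => cycl b (F S t e)).
Proof.
move=> hF; have h1 := term_quadD hF term_quad1; case: b => //.
apply: (term_quadD _ term_quad1); apply: (term_quadD _ hF); exact: term_quadX.
Qed.

End Terms.

Fixpoint term_rename V V' (s : V -> V') (u : term L_t V) : term L_t V' :=
  match u with
  | Var x => @Var L_t V' (s x)
  | Cst c => @Cst L_t V' c
  | App f us => @App L_t V' f (fun i => term_rename s (us i))
  end.

Lemma eval_rename V V' (s : V -> V') (u : term L_t V) (M : structure L_t) (e : V' -> M) :
  Defs.eval M e (term_rename s u) = Defs.eval M (fun x => e (s x)) u.
Proof.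
by elim: u => //= f us IH; congr (fn_interp M f _); apply/funext => i.
Qed.

Lemma term_fun_rename V V' (s : V -> V') (f : ring_fun V) : term_fun f ->
  term_fun (fun S t (e : V' -> S) => f S t (fun x => e (s x))).
Proof.
move=> [u1 [u2 fE]]; exists (term_rename s u1), (term_rename s u2) => S t e.
by rewrite fE !eval_rename.
Qed.

Lemma term_quad_rename V V' (s : V -> V') (F : quad_fun V) : term_quad F ->
  term_quad (fun S t (e : V' -> S) => F S t (fun x => e (s x))).
Proof.
by move=> [F1 F2]; split; [exact: (term_fun_rename s F1)|exact: (term_fun_rename s F2)].
Qed.

Section Closure.
Variable V : Type.
Implicit Types (P Q : ring_prop V) (f g : ring_fun V) (F G : quad_fun V).

Lemma pe_and P Q : pe_definable P -> pe_definable Q ->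
  pe_definable (fun S t e => P S t e /\ Q S t e).
Proof.
move=> [phi [phi_pe phiE]] [psi [psi_pe psiE]]; exists (And phi psi).
split; first by rewrite /= phi_pe.
by move=> S t e /=; split=> -[/phiE ? /psiE].
Qed.

Lemma pe_or P Q : pe_definable P -> pe_definable Q ->
  pe_definable (fun S t e => P S t e \/ Q S t e).
Proof.
move=> [phi [phi_pe phiE]] [psi [psi_pe psiE]]; exists (Or phi psi).
split; first by rewrite /= phi_pe.
by move=> S t e /=; split=> -[/phiE|/psiE]; by [left|right].
Qed.

Lemma pe_ex (P : forall (S : comNzRingType) (t : S), (V -> S) -> S -> Prop) :
  pe_definable (fun S t (e : option V -> S) => P S t (fun x => e (Some x)) (e None)) ->
  pe_definable (fun S t e => exists c, P S t e c).
Proof.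
move=> [phi [phi_pe phiE]]; exists (Ex phi); split=> // S t e /=.
by split=> -[c cP]; exists c; apply/(phiE S t (oapp e c)).
Qed.

Lemma pe_eq f g : term_fun f -> term_fun g ->
  pe_definable (fun S t e => f S t e = g S t e).
Proof.
move=> [f1 [f2 fE]] [g1 [g2 gE]].
exists (@Atom L_t V Eq (fun i : 'I_2 => if i == ord0 then op2 Add f1 g2 else op2 Add g1 f2)).
split=> // S t e /=; rewrite fE gE; rewrite /ring_rel_interp /=.
move: (Defs.eval _ _ f1) (Defs.eval _ _ f2) (Defs.eval _ _ g1) (Defs.eval _ _ g2).
move=> x y z w; split=> E; apply/eqP; rewrite -subr_eq0; apply/eqP.
  by rewrite -[RHS](subrr (z + y)) -{1}E; ring.
by rewrite -[RHS](subrr (z - w)) -{1}E; ring.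
Qed.

Lemma pe_qeq F G : term_quad F -> term_quad G ->
  pe_definable (fun S t e => F S t e = G S t e).
Proof.
move=> [F1 F2] [G1 G2]; have [phi [phi_pe phiE]] := pe_and (pe_eq F1 G1) (pe_eq F2 G2).
exists phi; split=> // S t e; split=> [/phiE|E]; last by apply/phiE; rewrite E.
by case: (F S t e) (G S t e) => ? ? [? ?] /= [-> ->].
Qed.

(** A quantifier over the quadratic extension is a pair of quantifiers. *)
Lemma pe_qex (P : forall (S : comNzRingType) (t : S), (V -> S) -> quad t -> Prop) :
  pe_definable (fun S t (e : option (option V) -> S) =>
    P S t (fun x => e (Some (Some x))) (Quad t (e (Some None)) (e None))) ->
  pe_definable (fun S t e => exists a, P S t e a).
Proof.
move=> [phi [phi_pe phiE]]; exists (Ex (Ex phi)); split=> // S t e /=.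
split=> [[c [d /(phiE S t (oapp (oapp e c) d)) cP]]|[[c d] cP]].
  by exists (Quad t c d).
by exists c, d; apply/(phiE S t (oapp (oapp e c) d)).
Qed.

End Closure.

Section DefinableRelations.
Variable V : Type.
Implicit Types (F G H : quad_fun V).

Lemma pe_qdvd F G : term_quad F -> term_quad G ->
  pe_definable (fun S t e => qdvd (F S t e) (G S t e)).
Proof.
move=> hF hG; apply: pe_qex; apply: pe_qeq; first exact: term_quad_rename.
by apply: term_quadM; [exact: term_quad_rename|exact: term_quad_var].
Qed.

Lemma pe_is_pow F : term_quad F -> pe_definable (fun S t e => is_pow (F S t e)).
Proof.
move=> hF; apply: pe_and.
  apply: pe_qeq; last exact: term_quad1.
  by apply: term_quadM => //; exact: term_quad_conj.
apply: pe_qdvd; apply: term_quadD => //.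
- exact: term_quad_u.
- by apply: term_quadN; exact: term_quad1.
- by apply: term_quadN; exact: term_quad1.
Qed.

Lemma pe_exp_dvd F G : term_quad F -> term_quad G ->
  pe_definable (fun S t e => exp_dvd (F S t e) (G S t e)).
Proof.
move=> hF hG; have h1 := term_quadN (@term_quad1 V).
by apply: pe_qdvd; exact: term_quadD.
Qed.

Lemma pe_exp_pdvd F G : term_quad F -> term_quad G ->
  pe_definable (fun S t e => exp_pdvd (F S t e) (G S t e)).
Proof.
move=> hF hG; have h1 := term_quadN (@term_quad1 V).
by apply: pe_qdvd; [apply: term_quadX|]; exact: term_quadD.
Qed.

Lemma pe_exp_sim F G : term_quad F -> term_quad G ->
  pe_definable (fun S t e => exp_sim (F S t e) (G S t e)).
Proof.
move=> hF hG; apply: pe_or; apply: pe_and.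
- apply: pe_ex; apply: pe_eq; last exact: term_fun1.
  by apply: term_funD; exact: term_fun_var.
- apply: pe_qex; apply: pe_qeq; last by apply: term_quadX; exact: term_quad_var.
  by apply: term_quadM; apply: term_quad_cycl; exact: term_quad_rename.
- apply: pe_eq; last exact: term_fun0.
  by apply: term_funD; exact: term_fun1.
- apply: pe_or; apply: pe_qex; apply: pe_qeq;
    try (by apply: term_quadX; exact: term_quad_var).
    by apply: term_quadM; apply: term_quad_cycl; exact: term_quad_rename.
  apply: term_quadM; last by apply: term_quad_cycl; exact: term_quad_rename.
  by apply: term_quadX; apply: term_quad_cycl; exact: term_quad_rename.
Qed.

Lemma pe_is_ppow F : term_quad F -> pe_definable (fun S t e => is_ppow (F S t e)).
Proof. by move=> hF; apply: pe_exp_sim => //; exact: term_quad_u. Qed.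

End DefinableRelations.

Ltac term_quad_tac := repeat first
  [ assumption | apply: term_quad1 | apply: term_quad_u | apply: term_quad_var
  | apply: term_quadM | apply: term_quadX | apply: term_quad_conj
  | apply: term_quad_rename ].

Lemma pe_exp_small V (F G : quad_fun V) : term_quad F -> term_quad G ->
  pe_definable (fun S t e => exp_small (F S t e) (G S t e)).
Proof.
move=> hF hG; apply: pe_qex; apply: pe_qex.
apply: pe_and; first by apply: pe_and; apply: pe_is_pow; term_quad_tac.
apply: pe_and; first by apply: pe_and; apply: pe_is_ppow; term_quad_tac.
apply: pe_and; first by apply: pe_exp_pdvd; term_quad_tac.
by apply: pe_and; apply: pe_exp_dvd; term_quad_tac.
Qed.

Lemma pe_ppow_sqr V (F G : quad_fun V) : term_quad F -> term_quad G ->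
  pe_definable (fun S t e => ppow_sqr (F S t e) (G S t e)).
Proof.
move=> hF hG; apply: pe_and; first by apply: pe_and; apply: pe_is_ppow.
by apply: pe_and; [apply: pe_exp_pdvd|apply: pe_exp_sim]; term_quad_tac.
Qed.

Lemma pe_exp_sqr V (F G : quad_fun V) : term_quad F -> term_quad G ->
  pe_definable (fun S t e => exp_sqr (F S t e) (G S t e)).
Proof.
move=> hF hG; do 3!apply: pe_qex.
apply: pe_and.
  by apply: pe_and; [|apply: pe_and]; apply: pe_is_pow; term_quad_tac.
apply: pe_and; first by apply: pe_and; apply: pe_exp_small; term_quad_tac.
apply: pe_and; first by apply: pe_and; apply: pe_ppow_sqr; term_quad_tac.
by apply: pe_exp_dvd; term_quad_tac.
Qed.

Lemma pe_exp_mul V (F G H : quad_fun V) : term_quad F -> term_quad G -> term_quad H ->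
  pe_definable (fun S t e => exp_mul (F S t e) (G S t e) (H S t e)).
Proof.
move=> hF hG hH; do 3!apply: pe_qex.
apply: pe_and.
  by apply: pe_and; [|apply: pe_and]; apply: pe_is_pow; term_quad_tac.
apply: pe_and; last by apply: pe_qeq; term_quad_tac.
by apply: pe_and; [|apply: pe_and]; apply: pe_exp_sqr; term_quad_tac.
Qed.

(** * The interpretation of the integers *)

Definition pair_quad (S : comNzRingType) (t : S) (e : 'I_2 -> S) : quad t :=
  Quad t (e ord0) (e ord_max).

Lemma term_quad_pair n (i : 'I_n) : term_quad (fun S t (e : 'I_n * 'I_2 -> S) =>
  pair_quad t (fun j => e (i, j))).
Proof. exact: term_quad_var. Qed.

(** The trivial absolute value of the field with two elements. *)
Lemma entire_pos_char_nonempty (K : realType) : exists N, @entire_pos_char K N.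
Proof.
pose f (x : 'F_2) : K := (x != 0)%:R.
have f0 x : 0 <= f x by rewrite ler0n.
have fe x : f x = 0 <-> x = 0.
  rewrite /f; case: eqVneq => [->|x0] /=; first by [].
  split=> [/eqP|x0']; first by rewrite oner_eq0.
  by rewrite x0' eqxx in x0.
have fM x y : f (x * y) = f x * f y.
  by rewrite /f mulf_eq0 negb_or -natrM mulnb.
have fU x y : f (x + y) <= Num.max (f x) (f y).
  rewrite /f le_max !ler_nat; have [->|] := eqVneq x 0; first by rewrite add0r leqnn orbT.
  by rewrite leq_b1.
exists (entire_structure (NonarchAbsval f0 fe fM fU)).
by apply: (@EntirePosChar K _ _ 2); rewrite pchar_Fp.
Qed.

Local Open Scope classical_set_scope.

Lemma power_preimageP (T M : Type) (k n : nat) (D : set ('I_k -> T))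
    (theta : D -> M) (X : set ('I_n -> M)) (Y : set ('I_n * 'I_k -> T)) :
  Y `<=` @set_power T k D n ->
  (forall x : 'I_n -> D, Y (fun ij => val (x ij.1) ij.2) <-> X (fun i => theta (x i))) ->
  power_preimage theta X = Y.
Proof.
move=> YD YX; apply/seteqP; split=> [e [x [xX ->]]|e Ye]; first exact/YX.
pose x i : D := SigSub (mem_set (YD _ Ye i)).
have ex : e = fun ij => val (x ij.1) ij.2 by apply/funext => -[i j].
by exists x; split=> //; apply/YX; rewrite -ex.
Qed.

Section Interp.
Variables (K : realType) (R : idomainType) (v : nonarch_absval K R).
Variables (p : nat).
Hypothesis pR : p \in [pchar R].
Notation A := (entire v).
Notation t := (entire_X v).
Local Notation upow := (qpow t).

Variable D : set ('I_2 -> A).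
Hypothesis DE : forall e, D e <-> is_pow (pair_quad t e).

Lemma exponent_exists (x : D) : exists n, pair_quad t (val x) = upow n.
Proof. by apply: (is_powP pR); apply/DE; exact: set_valP. Qed.

Definition exponent (x : D) : int := sval (cid (exponent_exists x)).

Lemma exponentE (x : D) : pair_quad t (val x) = upow (exponent x).
Proof. by rewrite /exponent; case: cid. Qed.

Lemma exponent_surj n : exists x, exponent x = n.
Proof.
pose e (i : 'I_2) := if i == ord0 then qre (upow n) else qim (upow n).
have eE : pair_quad t e = upow n by rewrite /pair_quad /e /=; case: (upow n).
have De : D e by apply/DE; rewrite eE; exact: is_pow_upow.
by exists (SigSub (mem_set De)); apply: (@qpow_inj _ _ v); rewrite -exponentE.
Qed.

End Interp.

Theorem theorem1p2 (K : realType) :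
  uniformly_pe_interpretable (ring_structure int) (@entire_pos_char K).
Proof.
split; first exact: entire_pos_char_nonempty.
have vq : term_quad (fun S t (e : 'I_2 -> S) => pair_quad t e) by exact: term_quad_var.
have [dom [dom_pe domE]] := pe_is_pow vq.
have [czero [zero_pe zeroE]] := pe_qeq vq (@term_quad1 _).
have [cone [one_pe oneE]] := pe_qeq vq (@term_quad_u _).
pose c n (i : 'I_n) := @term_quad_pair n i.
have [req [req_pe reqE]] := pe_and (pe_is_pow (c 2 ord0)) (pe_qeq (c 2 ord0) (c 2 ord_max)).
(* The arguments of a binary operation are read through [widen_ord], which
   agrees with 0 only up to a proof ([w0] below). *)
pose i0 : 'I_3 := ord0; pose i1 : 'I_3 := widen_ord (leqnSn _) ord_max; pose i2 : 'I_3 := ord_max.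
have dom3 := pe_and (pe_is_pow (c 3 i0)) (pe_and (pe_is_pow (c 3 i1)) (pe_is_pow (c 3 i2))).
have [fadd [add_pe addE]] := pe_and dom3 (pe_qeq (c 3 i2) (term_quadM (c 3 i0) (c 3 i1))).
have [fmul [mul_pe mulE]] := pe_and dom3 (pe_exp_mul (c 3 i0) (c 3 i1) (c 3 i2)).
exists (@InterpFormulas L_ring L_t 2 dom
  (fun s => match s with Zero => czero | One => cone end)
  (fun s => match s with Eq => req end)
  (fun f => match f with Add => fadd | Mul => fmul end)).
split; first by split=> // -[].
move=> _ [R v p pR].
pose D := realization (entire_structure v) dom.
have DE e : D e <-> is_pow (pair_quad (entire_X v) e) by exact: domE.
exists (exponent pR DE); split => /=.
- by move=> n _; have [x <-] := exponent_surj pR DE n; exists x.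
- have cst_case phi n : (forall e, sat (entire_structure v) phi e <->
        pair_quad (entire_X v) e = qpow (entire_X v) n) ->
      realization (entire_structure v) phi `<=` D /\
      [set val x | x in exponent pR DE @^-1` [set n]] = realization (entire_structure v) phi.
    move=> phiE; have sub : realization (entire_structure v) phi `<=` D.
      by move=> e /phiE eE; apply/DE; rewrite eE; exact: is_pow_upow.
    split=> //; apply/seteqP; split=> [_ [x /= xn <-]|e he].
      by apply/phiE; rewrite (exponentE pR DE) xn.
    exists (SigSub (mem_set (sub _ he))) => //=.
    by apply: (@qpow_inj _ _ v); rewrite -exponentE; exact/phiE.
  by case; apply: cst_case => e; [exact: zeroE|exact: oneE].
- case=> /=; have sub : realization (entire_structure v) req `<=`
      @set_power (entire_structure v) 2 D 2.
    move=> e /reqE[e0 e01] i; apply/DE; case: i => -[|[|//]] i.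
      by rewrite (_ : Ordinal i = ord0); last exact: val_inj.
    rewrite (_ : Ordinal i = ord_max); last exact: val_inj.
    by rewrite -e01.
  split=> //; apply: power_preimageP => // x.
  have E i := exponentE pR DE (x i).
  split=> [/reqE[_ e01]|e01]; last first.
    apply/reqE; split; first by apply/DE; exact: (set_valP (x ord0)).
    by rewrite !E; congr qpow.
  have : qpow (entire_X v) (exponent pR DE (x ord0)) =
      qpow (entire_X v) (exponent pR DE (x ord_max)) by rewrite -!E.
  exact: qpow_inj.
- have fn_sub phi (P : ('I_3 * 'I_2 -> entire v) -> Prop) :
      (forall (e : 'I_3 * 'I_2 -> entire v), sat (entire_structure v) phi e <->
        (is_pow (pair_quad (entire_X v) (fun j => e (i0, j))) /\
        is_pow (pair_quad (entire_X v) (fun j => e (i1, j))) /\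
        is_pow (pair_quad (entire_X v) (fun j => e (i2, j)))) /\ P e) ->
      realization (entire_structure v) phi `<=` @set_power (entire_structure v) 2 D 3.
    move=> phiE e /phiE[[h0 [h1 h2]] _] i; apply/DE; case: i => -[|[|[|//]]] i.
    + by rewrite (_ : Ordinal i = i0); last exact: val_inj.
    + by rewrite (_ : Ordinal i = i1); last exact: val_inj.
    + by rewrite (_ : Ordinal i = i2); last exact: val_inj.
  have w0 : widen_ord (leqnSn 2) ord0 = i0 by exact: val_inj.
  have E (x : 'I_3 -> D) i := exponentE pR DE (x i).
  have in_dom (x : 'I_3 -> D) i : is_pow (pair_quad (entire_X v) (val (x i))).
    by apply/DE; exact: (set_valP (x i)).
  case=> /=.
  + have sub := fn_sub _ _ (addE _ _); split=> //; apply: power_preimageP => // x.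
    rewrite /fn_graph /= w0; split=> [/addE[_ xE]|xE].
      by apply: (@qpow_inj _ _ v); rewrite qpowD -!E.
    apply/addE; split; first by split; [|split]; exact: in_dom.
    by rewrite !E -qpowD; congr qpow.
  + have sub := fn_sub _ _ (mulE _ _); split=> //; apply: power_preimageP => // x.
    rewrite /fn_graph /= w0; split=> [/mulE[_]|xE].
      by rewrite !E => /(exp_mul_upow v pR) ->.
    apply/mulE; split; first by split; [|split]; exact: in_dom.
    by rewrite !E; apply/(exp_mul_upow v pR).
Qed.
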